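(* Let $X$ be a connected complete $n$-dimensional Riemannian manifold with volume measure $\mathrm{vol}$ and let $\kappa>0$. Let $\mu_0,\mu_1$ be probability measures on $X$ with $\mu_0\ll\mathrm{vol}$, and let $(v^S_0,\alpha^S_0,(\mu^S_1)^\perp)=\mathrm{Log}^{\mathrm{SHK}_\kappa}_{\mu_0}(\mu_1)$ be the logarithmic map for the spherical Hellinger--Kantorovich distance (defined in the context). Then $$\mathrm{SHK}_\kappa^2(\mu_0,\mu_1)=\|v_0^S\|^2_{L^2(\mu_0)}+\frac{\kappa^2}{4}\|\alpha_0^S\|^2_{L^2(\mu_0)}+\kappa^2\,|(\mu^S_1)^\perp|.$$
   Context: $|\mu|$ denotes total mass; $d$ is the Riemannian distance; $\#$ denotes push-forward; $p_i:X\times X\to X$, $(x_0,x_1)\mapsto x_i$. $\mathrm{Log}^X_x(y)\in T_xX$ is the initial velocity of smallest norm of a geodesic going from $x$ to $y$ in unit time (where defined), so $\|\mathrm{Log}^X_x(y)\|_x=d(x,y)$. $\|v\|^2_{L^2(\mu_0)}=\int\|v(x)\|_x^2\,d\mu_0(x)$ for vector fields. Hellinger--Kantorovich distance, soft-marginal problem (P): $$\mathrm{HK}_\kappa^2(\mu_0,\mu_1)=\inf_{\pi}\ \int_{X\times X} c_\kappa\,d\pi+\kappa^2\,\mathrm{KL}(p_{0\#}\pi|\mu_0)+\kappa^2\,\mathrm{KL}(p_{1\#}\pi|\mu_1),$$ over non-negative (finite Radon) measures $\pi$ on $X\times X$, where $c_\kappa(x_0,x_1)=-2\kappa^2\log\cos(d(x_0,x_1)/\kappa)$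 if $d(x_0,x_1)<\kappa\pi/2$ and $+\infty$ otherwise, and $\mathrm{KL}(\rho|\mu)=\int\log(\frac{d\rho}{d\mu})\,d\rho-|\rho|+|\mu|$ if $\rho\ll\mu$ (with $\rho,\mu\ge0$), $+\infty$ otherwise. Spherical Hellinger--Kantorovich distance, for probability measures: $\mathrm{SHK}_\kappa(\mu_0,\mu_1)=\kappa\arccos\left(1-\frac{\mathrm{HK}_\kappa^2(\mu_0,\mu_1)}{2\kappa^2}\right)$. When $\mu_0\ll\mathrm{vol}$, the minimizer of (P) is unique and of the form $\pi=(\mathrm{id},T)_\#\pi_0$ with $\pi_0=p_{0\#}\pi$; set $\pi_1=p_{1\#}\pi=T_\#\pi_0$. Consider the Lebesgue decompositions $\mu_i=\frac{d\mu_i}{d\pi_i}\pi_i+\mu_i^\perp$, $i=0,1$ ($\mu_i^\perp$ singular with respect to $\pi_i$). Logarithmic map for $\mathrm{HK}_\kappa$: $\mathrm{Log}^{\mathrm{HK}_\kappa}_{\mu_0}(\mu_1):=(v_0,\alpha_0,\mu_1^\perp)$, where for $\pi_0$-a.e. $x$: $v_0(x)=\kappa\frac{d\pi_0}{d\mu_0}(x)\tan\left(\frac{\|\mathrm{Log}^X_x(T(x))\|}{\kappa}\right)\frac{\mathrm{Log}^X_x(T(x))}{\|\mathrm{Log}^X_x(T(x))\|}$ (read as $0$ if $T(x)=x$) and $\alpha_0(x)=2\left(\frac{d\pi_0}{d\mu_0}(x)-1\right)$; for $\mu_0^\perp$-a.e. $x$: $v_0(x)=0$ and $\alpha_0(x)=-2$.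 Logarithmic map for $\mathrm{SHK}_\kappa$: with $(v_0,\alpha_0,\mu_1^\perp)=\mathrm{Log}^{\mathrm{HK}_\kappa}_{\mu_0}(\mu_1)$ and the scalar $s'(0)=\frac{\mathrm{SHK}_\kappa(\mu_0,\mu_1)/\kappa}{\sin(\mathrm{SHK}_\kappa(\mu_0,\mu_1)/\kappa)}$ (read as $1$ if $\mathrm{SHK}_\kappa(\mu_0,\mu_1)=0$), $\mathrm{Log}^{\mathrm{SHK}_\kappa}_{\mu_0}(\mu_1):=(v^S_0,\alpha^S_0,(\mu^S_1)^\perp)$ with $$v_0^S=s'(0)\,v_0,\qquad \alpha_0^S=s'(0)\left(\alpha_0+\mathrm{HK}_\kappa^2(\mu_0,\mu_1)/\kappa^2\right),\qquad (\mu_1^S)^\perp=s'(0)^2\,\mu_1^\perp.$$ *)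

(* Defs.v *)
From HB Require Import structures.
From mathcomp Require Import all_boot all_order all_algebra.
From mathcomp Require Import all_classical all_reals all_analysis measurable_realfun.

Set Implicit Arguments.
Unset Strict Implicit.
Unset Printing Implicit Defensive.

Import Order.TTheory GRing.Theory Num.Theory.
Import numFieldNormedType.Exports.

Local Open Scope classical_set_scope.
Local Open Scope ring_scope.
Local Open Scope charge_scope.

(* Pointedness is what the measure theory library requires of a measurable
   space; it is harmless, as the spaces below carry a probability measure. *)
#[short(type="pmetricType")]
HB.structure Definition PointedMetric (K : numDomainType) :=
  {T of Pointed T & Metric K T}.

Definition metrically_complete (R : realType) (X : pmetricType R) : Prop :=
  forall F : set_system X, ProperFilter F -> cauchy F -> cvg F.

Notation borel X := (g_sigma_algebraType (@open X)).

Section calculus.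
Context {R : realType} {V W : normedModType R}.

(* For an open O in a finite-dimensional space V, this is the class C^k. *)
Fixpoint C_on (k : nat) (O : set V) (f : V -> W) : Prop :=
  (forall x, O x -> {for x, continuous f}) /\
  if k is k'.+1 then
    forall v, (forall x, O x -> derivable f x v) /\
              C_on k' O (fun x => 'D_v f x)
  else True.

Definition smooth_on (O : set V) (f : V -> W) : Prop := forall k, C_on k O f.

End calculus.

(* The metric tensor is given by its Gram matrices: [gram i y] is the matrix of
   the scalar product at the point of coordinates [y] in the chart [i].
   [chart_at x] is a preferred chart around [x]: a tangent vector at [x] is
   represented by its coordinates, a row vector, in the chart [chart_at x]. *)
Record riemannian_structure (R : realType) (n : nat) (X : pmetricType R) :=
  RiemannianStructure {
  chart_index : Type;
  dom : chart_index -> set X;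
  chart : chart_index -> X -> 'rV[R]_n;
  chart_inv : chart_index -> 'rV[R]_n -> X;
  chart_at : X -> chart_index;
  gram : chart_index -> 'rV[R]_n -> 'M[R]_n;
  manifold_second_countable : @second_countable X;
  dom_chart_at : forall x, dom (chart_at x) x;
  open_dom : forall i, open (dom i);
  open_codom : forall i, open (chart i @` dom i);
  chartK : forall i x, dom i x -> chart_inv i (chart i x) = x;
  chart_continuous : forall i x, dom i x -> {for x, continuous (chart i)};
  chart_inv_continuous : forall i y, (chart i @` dom i) y ->
    {for y, continuous (chart_inv i)};
  transition_smooth : forall i j,
    smooth_on (chart i @` (dom i `&` dom j)) (chart j \o chart_inv i);
  gram_smooth : forall i, smooth_on (chart i @` dom i) (gram i);
  gram_sym : forall i y, (chart i @` dom i) y -> (gram i y)^T = gram i y;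
  gram_pos : forall i y (u : 'rV[R]_n), (chart i @` dom i) y -> u != 0 ->
    0 < (u *m gram i y *m u^T) 0 0;
  gram_transition : forall i j x (u w : 'rV[R]_n), dom i x -> dom j x ->
    let tau := chart j \o chart_inv i in
    (u *m gram i (chart i x) *m w^T) 0 0 =
    ('D_u tau (chart i x) *m gram j (chart j x)
       *m ('D_w tau (chart i x))^T) 0 0
}.

Arguments dom {R n X} M i x : rename.
Arguments chart {R n X} M i x : rename.
Arguments chart_inv {R n X} M i y : rename.
Arguments chart_at {R n X} M x : rename.
Arguments gram {R n X} M i y : rename.

Section riemannian.
Context {R : realType} {n : nat} {X : pmetricType R}.
Variable M : riemannian_structure n X.

Definition tangent_norm (x : X) (v : 'rV[R]_n) : R :=
  let i := chart_at M x in
  Num.sqrt ((v *m gram M i (chart M i x) *m v^T) 0 0).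

Definition velocity (gamma : R -> X) (t : R) : 'rV[R]_n :=
  derive1 (chart M (chart_at M (gamma t)) \o gamma) t.

Definition C1_curve (a b : R) (gamma : R -> X) : Prop :=
  forall t, a < t < b -> {for t, continuous gamma} /\
    forall i, dom M i (gamma t) ->
      (\forall s \near t, derivable (chart M i \o gamma) s 1) /\
      {for t, continuous (derive1 (chart M i \o gamma))}.

(* [s] lists the positive subdivision points; on each closed piece the curve
   agrees with one that is C^1 on a larger open interval. *)
Definition piecewise_C1_curve (gamma : R -> X) : Prop :=
  exists s : seq R, [/\ path <%R 0 s, last 0 s = 1 &
    forall k, (k < size s)%N ->
      let a := nth 0 (0 :: s) k in let b := nth 0 s k in
      exists2 e : R, 0 < e & exists2 eta : R -> X,
        C1_curve (a - e) (b + e) eta & {in `[a, b], eta =1 gamma}].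

(* The velocity is meaningless at the finitely many breakpoints, a null set. *)
Definition curve_length (gamma : R -> X) : \bar R :=
  (\int[lebesgue_measure]_(t in `[0%R, 1%R])
     (tangent_norm (gamma t) (velocity gamma t))%:E)%E.

Definition riemannian_distance (x y : X) : \bar R :=
  ereal_inf [set curve_length gamma | gamma in
    [set gamma | [/\ piecewise_C1_curve gamma, gamma 0 = x & gamma 1 = y]]].

(* On a connected Riemannian manifold the Riemannian distance is a finite
   distance inducing the manifold topology, so it may be taken as the metric
   of the ambient metric space. *)
Definition is_riemannian_metric : Prop :=
  forall x y : X, (mdist x y)%:E = riemannian_distance x y.

(* [christoffel i y k a b] is Gamma^k_{ab} at [y] in the chart [i]. *)
Definition christoffel (i : chart_index M) (y : 'rV[R]_n) (k a b : 'I_n) : R :=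
  2^-1 * \sum_(l < n) invmx (gram M i y) k l *
    ('D_(delta_mx 0 a) (fun z => gram M i z l b) y
     + 'D_(delta_mx 0 b) (fun z => gram M i z l a) y
     - 'D_(delta_mx 0 l) (fun z => gram M i z a b) y).

Definition geodesic (gamma : R -> X) : Prop :=
  exists2 e : R, 0 < e & forall t, - e < t < 1 + e ->
    {for t, continuous gamma} /\
    forall i, dom M i (gamma t) ->
      let c : R -> 'rV[R]_n := chart M i \o gamma in
      [/\ \forall s \near t, derivable c s 1,
          derivable (derive1 c) t 1 &
          forall k : 'I_n, (derive1 (derive1 c) t) 0 k
            + \sum_(a < n) \sum_(b < n)
                christoffel i (c t) k a b
                * (derive1 c t) 0 a * (derive1 c t) 0 b = 0].

Definition geodesic_from_to (x y : X) (gamma : R -> X) : Prop :=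
  [/\ geodesic gamma, gamma 0 = x & gamma 1 = y].

(* The relation "[v] is Log_x(y)"; it is not required that only one initial
   velocity has the smallest norm. By Hopf-Rinow, the last clause follows from
   the first two on a complete connected manifold. *)
Definition is_manifold_log (x y : X) (v : 'rV[R]_n) : Prop :=
  [/\ exists2 gamma, geodesic_from_to x y gamma & velocity gamma 0 = v,
      forall gamma, geodesic_from_to x y gamma ->
        tangent_norm x v <= tangent_norm x (velocity gamma 0) &
      tangent_norm x v = mdist x y].

Definition is_lebesgue_rV
    (lambda : {measure set (borel 'rV[R]_n) -> \bar R}) : Prop :=
  forall a b : 'rV[R]_n, (forall j, a 0 j <= b 0 j) ->
    lambda [set x | forall j, a 0 j <= x 0 j <= b 0 j] =
    (\prod_(j < n) (b 0 j - a 0 j))%:E.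

Definition is_riemannian_volume
    (vol : {measure set (borel X) -> \bar R}) : Prop :=
  exists2 lambda : {measure set (borel 'rV[R]_n) -> \bar R},
    is_lebesgue_rV lambda &
    forall i (A : set (borel X)), measurable A -> A `<=` dom M i ->
      vol A = (\int[lambda]_(y in chart M i @` A)
                 (Num.sqrt (\det (gram M i y)))%:E)%E.

Definition L2norm_sq_vector (mu : {measure set (borel X) -> \bar R})
    (v : X -> 'rV[R]_n) : \bar R :=
  (\int[mu]_x ((tangent_norm x (v x)) ^+ 2)%:E)%E.

Definition L2norm_sq (mu : {measure set (borel X) -> \bar R})
    (a : X -> R) : \bar R :=
  (\int[mu]_x ((a x) ^+ 2)%:E)%E.

End riemannian.

Section marginals.
Context {d1 d2 : measure_display} {T1 : measurableType d1}
  {T2 : measurableType d2} {R : realType}.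
Variable plan : {finite_measure set (T1 * T2)%type -> \bar R}.

Definition marginal0 : set T1 -> \bar R := pushforward plan fst.
Definition marginal1 : set T2 -> \bar R := pushforward plan snd.

Let marginal0_set0 : marginal0 set0 = 0%E.
Proof. by rewrite /marginal0 /pushforward preimage_set0 measure0. Qed.

Let marginal0_ge0 A : (0 <= marginal0 A)%E.
Proof. exact: measure_ge0. Qed.

Let marginal0_sigma_additive : semi_sigma_additive marginal0.
Proof. by apply: measure_semi_sigma_additive; exact: measurable_fst. Qed.

Let marginal0_fin : fin_num_fun marginal0.
Proof.
move=> A mA; apply: fin_num_measure; rewrite -[_ @^-1` _]setTI.
exact: measurable_fst.
Qed.

HB.instance Definition _ := isMeasure.Build _ _ _ marginal0
  marginal0_set0 marginal0_ge0 marginal0_sigma_additive.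
HB.instance Definition _ :=
  Measure_isFinite.Build _ _ _ marginal0 marginal0_fin.

Let marginal1_set0 : marginal1 set0 = 0%E.
Proof. by rewrite /marginal1 /pushforward preimage_set0 measure0. Qed.

Let marginal1_ge0 A : (0 <= marginal1 A)%E.
Proof. exact: measure_ge0. Qed.

Let marginal1_sigma_additive : semi_sigma_additive marginal1.
Proof. by apply: measure_semi_sigma_additive; exact: measurable_snd. Qed.

Let marginal1_fin : fin_num_fun marginal1.
Proof.
move=> A mA; apply: fin_num_measure; rewrite -[_ @^-1` _]setTI.
exact: measurable_snd.
Qed.

HB.instance Definition _ := isMeasure.Build _ _ _ marginal1
  marginal1_set0 marginal1_ge0 marginal1_sigma_additive.
HB.instance Definition _ :=
  Measure_isFinite.Build _ _ _ marginal1 marginal1_fin.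

End marginals.

Section densities.
Context {d : measure_display} {T : measurableType d} {R : realType}.

Definition density (rho mu : {finite_measure set T -> \bar R}) : T -> \bar R :=
  'd (charge_of_finite_measure rho) '/d mu.

Definition KL (rho mu : {finite_measure set T -> \bar R}) : \bar R :=
  (if `[< rho `<< mu >]
   then \int[rho]_x lne (density rho mu x) - rho setT + mu setT
   else +oo)%E.

Definition mutually_singular (m1 m2 : {measure set T -> \bar R}) : Prop :=
  exists N : set T, [/\ measurable N, m1 N = 0%E & m2 (~` N) = 0%E].

Definition lebesgue_decomposition (mu rho : {measure set T -> \bar R})
    (f : T -> \bar R) (mu_s : {measure set T -> \bar R}) : Prop :=
  [/\ measurable_fun setT f, forall x, (0 <= f x)%E,
      forall A, measurable A -> mu A = (\int[rho]_(x in A) f x + mu_s A)%E &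
      mutually_singular mu_s rho].

End densities.

Section hellinger_kantorovich.
Context {R : realType} {X : pmetricType R}.
Variable kappa : R.

Definition HK_cost (z : borel X * borel X) : \bar R :=
  let r := mdist (z.1 : X) z.2 in
  if r < kappa * pi / 2 then (- 2 * kappa ^+ 2 * ln (cos (r / kappa)))%:E
  else +oo%E.

Definition HK_objective (mu0 mu1 : {finite_measure set (borel X) -> \bar R})
    (plan : {finite_measure set (borel X * borel X)%type -> \bar R}) : \bar R :=
  (\int[plan]_z HK_cost z + (kappa ^+ 2)%:E * KL (marginal0 plan) mu0
     + (kappa ^+ 2)%:E * KL (marginal1 plan) mu1)%E.

Definition HK_sq (mu0 mu1 : {finite_measure set (borel X) -> \bar R}) :
    \bar R :=
  ereal_inf [set HK_objective mu0 mu1 plan | plan in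
    [set: {finite_measure set (borel X * borel X)%type -> \bar R}]].

Definition HK_optimal (mu0 mu1 : {finite_measure set (borel X) -> \bar R})
    (plan : {finite_measure set (borel X * borel X)%type -> \bar R}) : Prop :=
  HK_objective mu0 mu1 plan = HK_sq mu0 mu1.

(* The infimum is finite: the null plan has value kappa^2 (|mu0| + |mu1|). *)
Definition SHK (mu0 mu1 : probability (borel X) R) : R :=
  kappa * acos (1 - fine (HK_sq mu0 mu1) / (2 * kappa ^+ 2)).

Definition SHK_speed (mu0 mu1 : probability (borel X) R) : R :=
  let theta := SHK mu0 mu1 / kappa in
  if theta == 0 then 1 else theta / sin theta.

Context {n : nat}.
Variable M : riemannian_structure n X.

(* The relation "[(v0, alpha0, mu1_s)] is the logarithmic map at [mu0] of
   [mu1]": the vector field [v0] and the function [alpha0] are only determined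
   up to [mu0]-null sets, and [mu0_s], [mu1_s] are the singular parts of
   [mu0], [mu1] with respect to the marginals of the optimal plan. *)
Definition is_HK_log (mu0 mu1 : {finite_measure set (borel X) -> \bar R})
    (v0 : X -> 'rV[R]_n) (alpha0 : X -> R)
    (mu1_s : {measure set (borel X) -> \bar R}) : Prop :=
  exists (plan : {finite_measure set (borel X * borel X)%type -> \bar R})
         (T : borel X -> borel X)
         (f0 f1 : borel X -> \bar R)
         (mu0_s : {measure set (borel X) -> \bar R}),
  let sigma0 x := fine (density (marginal0 plan) mu0 x) in
  [/\ HK_optimal mu0 mu1 plan,
      measurable_fun setT T /\
      (forall A, measurable A ->
         plan A = pushforward (marginal0 plan) (fun x => (x, T x)) A),
      lebesgue_decomposition mu0 (marginal0 plan) f0 mu0_s /\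
      lebesgue_decomposition mu1 (marginal1 plan) f1 mu1_s,
      {ae marginal0 plan, forall x,
         [/\ T x = x -> v0 x = 0,
             T x <> x -> exists2 L, is_manifold_log M x (T x) L &
               v0 x = (kappa * sigma0 x * tan (tangent_norm M x L / kappa)
                       / tangent_norm M x L) *: L &
             alpha0 x = 2 * (sigma0 x - 1)]} &
      {ae mu0_s, forall x, v0 x = 0 /\ alpha0 x = -2}].

Definition is_SHK_log (mu0 mu1 : probability (borel X) R)
    (vS : X -> 'rV[R]_n) (alphaS : X -> R)
    (mu1S_s : {measure set (borel X) -> \bar R}) : Prop :=
  exists (v0 : X -> 'rV[R]_n) (alpha0 : X -> R)
         (mu1_s : {measure set (borel X) -> \bar R}),
  let s := SHK_speed mu0 mu1 in
  [/\ is_HK_log mu0 mu1 v0 alpha0 mu1_s,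
      forall x, vS x = s *: v0 x,
      forall x, alphaS x =
        s * (alpha0 x + fine (HK_sq mu0 mu1) / kappa ^+ 2) &
      forall A, measurable A -> mu1S_s A = ((s ^+ 2)%:E * mu1_s A)%E].

End hellinger_kantorovich.

(* Main.v *)
Require Import Defs.
From HB Require Import structures.
From mathcomp Require Import all_boot all_order all_algebra.
From mathcomp Require Import all_classical all_reals all_analysis measurable_realfun.
From mathcomp Require Import ring lra.

(** The identity reduces to the first-order optimality condition of the plan.

    Let [pi] be the optimal plan, [pi0], [pi1] its marginals, [r0], [r1] their
    densities with respect to [mu0], [mu1], and [m] its mass.  Multiplying [pi]
    by a constant [l > 0] on a measurable set [A], and leaving it alone outside
    of [A], gives a competitor.  Since the entropy [s ln s - s + 1] is convex,
    the derivative of the objective at [l = 1] is the integral over [A] of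
    [c + kappa^2 (ln r0(x0) + ln r1(x1))].  It vanishes for every [A], so that
    [r0(x0) r1(x1) = cos^2 (d(x0, x1) / kappa)] holds [pi]-almost everywhere
    ([optimality_condition], [plan_ae_cos]).
    Two consequences follow.

    - The cost cancels against the logarithms in the two relative entropies and
      [HK^2 = 2 kappa^2 (1 - m)] remains ([HK_sq_mass]).  Hence
      [SHK = kappa acos m], the correction [HK^2 / kappa^2] in the spherical
      logarithm turns [2 (r0 - 1)] into [2 (r0 - m)], and the squared speed
      [s'(0)^2] times [1 - m^2] is [acos(m)^2] ([speed_sqr]).
    - As [1 + tan^2 = 1 / cos^2], the density [r0^2 tan^2 + r0^2] equals
      [r0 / r1(T)], whose [mu0]-integral is the [pi1]-integral of [1 / r1], that
      is, the [mu1]-mass of [{r1 > 0}] ([integral_transport_ratio]).  The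
      singular part of [mu1] has exactly the mass of [{r1 = 0}]
      ([singular_partE]), so both add up to one.  Expanding [(r0 - m)^2], where
      [r0] has [mu0]-integral [m], the energy is a multiple of [1 - m^2]
      ([spherical_energy]).

    The velocity field is an arbitrary function known only almost everywhere
    and may fail to be measurable.  This does no harm: the integral of a
    nonnegative function is a supremum over simple functions below it, which
    depends only on the almost-everywhere class ([integral_ge0_ae_eq]). *)

Import Order.TTheory GRing.Theory Num.Theory.
Import numFieldNormedType.Exports.

Local Open Scope classical_set_scope.
Local Open Scope ring_scope.

Set Implicit Arguments.
Unset Strict Implicit.
Unset Printing Implicit Defensive.

(** * Densities *)

Section density.
Context d (T : measurableType d) (R : realType).
Local Open Scope ereal_scope.
Import HBNNSimple.

Definition has_density (nu mu : {measure set T -> \bar R}) (w : T -> R) : Prop :=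
  [/\ measurable_fun setT w, forall x, (0 <= w x)%R &
      forall A, measurable A -> nu A = \int[mu]_(x in A) (w x)%:E].

(** A simple function below [f] becomes, once set to zero on a null set, a
    simple function below [g] with the same integral; the two suprema defining
    the integrals therefore agree, whether or not [f] and [g] are measurable. *)
Lemma integral_ge0_ae_eq (mu : {measure set T -> \bar R}) (f g : T -> \bar R) :
  (forall x, 0 <= f x) -> (forall x, 0 <= g x) ->
  {ae mu, forall x, f x = g x} -> \int[mu]_x f x = \int[mu]_x g x.
Proof.
suff le (h k : T -> \bar R) : (forall x, 0 <= h x) -> (forall x, 0 <= k x) ->
    {ae mu, forall x, h x = k x} -> \int[mu]_x h x <= \int[mu]_x k x.
  move=> f0 g0 fg; apply/eqP; rewrite eq_le !le//.
  by apply: filterS fg => x ->.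
move=> h0 k0 [N [mN N0 hkN]]; rewrite !ge0_integralTE//.
apply: ge_ereal_sup => _ [s /= sh <-].
have mNC := measurableC mN.
pose s' : {nnsfun T >-> R} := mul_nnsfun s (indic_nnsfun R mNC).
apply: le_ereal_sup_tmp; exists (sintegral mu s'); first exists s' => //= x.
  rewrite /mindic indicE; case: (boolP (x \in ~` N)) => [|_]; last first.
    by rewrite mulr0.
  rewrite inE /= => Nx; rewrite mulr1.
  suff <- : h x = k x by [].
  by apply: contrapT => hk; apply: Nx; exact: hkN.
rewrite -!integralT_nnsfun le_eqVlt; apply/orP; left; apply/eqP.
apply: ge0_ae_eq_integral => //.
- exact/measurable_EFinP/measurable_funP.
- exact/measurable_EFinP/measurable_funP.
- by move=> x _; rewrite lee_fin.
- by move=> x _; rewrite lee_fin.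
exists N; split => // x /= /not_implyP[_] h1; apply: contrapT => Nx; apply: h1.
by rewrite /mindic indicE mem_set//= mulr1.
Qed.

Section one_density.
Variables (nu mu : {finite_measure set T -> \bar R}).

Lemma has_density_dominates w : has_density nu mu w -> nu `<< mu.
Proof.
move=> [mw w0 h]; apply/null_content_dominatesP => A mA A0; rewrite h//.
by apply: null_set_integral => //; exact/measurable_EFinP/measurable_funTS.
Qed.

Lemma has_density_integrable w : has_density nu mu w ->
  mu.-integrable setT (EFin \o w).
Proof.
move=> [mw w0 h]; apply/integrableP; split; first exact/measurable_EFinP.
under eq_integral do rewrite /= ger0_norm//.
by rewrite -h// ltey_eq fin_num_measure.
Qed.

Lemma has_density_ae w w' : has_density nu mu w -> has_density nu mu w' ->
  {ae mu, forall x, w x = w' x}.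
Proof.
move=> hw hw'; have := has_density_integrable hw.
move: (hw) (hw') => [mw w0 h] [mw' w0' h'] iw.
have : ae_eq mu setT (EFin \o w) (EFin \o w').
  apply: integral_ae_eq => //; first exact/measurable_EFinP.
  by move=> E _ mE; rewrite -h// -h'.
by apply: filterS => x /(_ I) /= [].
Qed.

Lemma has_density_dominated : nu `<< mu ->
  has_density nu mu (fine \o Radon_Nikodym_SigmaFinite.f nu mu).
Proof.
move=> numu; have fi := Radon_Nikodym_SigmaFinite.f_integrable numu.
split.
- by apply: measurableT_comp => //; exact: measurable_int fi.
- by move=> x /=; rewrite fine_ge0// Radon_Nikodym_SigmaFinite.f_ge0.
move=> A mA.
etransitivity; first exact: (Radon_Nikodym_SigmaFinite.f_integral numu mA).
apply: eq_integral => x _ /=; rewrite fineK//.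
exact: Radon_Nikodym_SigmaFinite.f_fin_num.
Qed.

Lemma density_ae w : has_density nu mu w ->
  {ae mu, forall x, density nu mu x = (w x)%:E}.
Proof.
move=> hw; have numu := has_density_dominates hw.
have := ae_eq_Radon_Nikodym_SigmaFinite numu measurableT.
apply: filterS2 (has_density_ae (has_density_dominated numu) hw) => x.
move=> /= <- /(_ I) h; rewrite fineK; first by rewrite /density h.
exact: Radon_Nikodym_SigmaFinite.f_fin_num.
Qed.

Lemma ge0_integral_density w (f : T -> \bar R) : has_density nu mu w ->
  measurable_fun setT f -> (forall x, 0 <= f x) ->
  \int[nu]_x f x = \int[mu]_x (f x * (w x)%:E).
Proof.
move=> hw mf f0; have numu := has_density_dominates hw.
have fi := Radon_Nikodym_SigmaFinite.f_integrable numu.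
rewrite -(Radon_Nikodym_SigmaFinite.change_of_variables numu)//.
have [mw w0 _] := hw.
apply: integral_ge0_ae_eq => [x|x|].
- by rewrite mule_ge0// Radon_Nikodym_SigmaFinite.f_ge0.
- by rewrite mule_ge0// lee_fin.
apply: filterS (has_density_ae (has_density_dominated numu) hw) => x /= <-.
by rewrite fineK//; exact: Radon_Nikodym_SigmaFinite.f_fin_num.
Qed.

Lemma integral_density w (f : T -> \bar R) : has_density nu mu w ->
  measurable_fun setT f ->
  \int[nu]_x f x = \int[mu]_x (f x * (w x)%:E).
Proof.
move=> hw mf; have [mw w0 _] := hw.
rewrite integralE [RHS]integralE; congr (_ - _).
  rewrite (ge0_integral_density hw)//; last exact: measurable_funepos.
  apply: eq_integral => x _; rewrite !funeposE muleC.
  by rewrite maxe_pMr ?mule0 1?muleC ?lee_fin.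
rewrite (ge0_integral_density hw)//; last exact: measurable_funeneg.
apply: eq_integral => x _; rewrite !funenegE muleC.
by rewrite maxe_pMr ?mule0 ?lee_fin// muleN muleC.
Qed.

Lemma integrable_densityP w (f : T -> \bar R) : has_density nu mu w ->
  measurable_fun setT f ->
  nu.-integrable setT f <-> mu.-integrable setT (fun x => f x * (w x)%:E).
Proof.
move=> hw mf; have [mw w0 _] := hw.
have mfw : measurable_fun setT (fun x => f x * (w x)%:E).
  by apply: emeasurable_funM => //; exact/measurable_EFinP.
have e : \int[nu]_x `|f x| = \int[mu]_x `|f x * (w x)%:E|.
  rewrite (ge0_integral_density hw)//; last exact: measurableT_comp.
  by apply: eq_integral => x _; rewrite abseM (gee0_abs (x := (w x)%:E))// lee_fin.
by split=> /integrableP[_ h]; apply/integrableP; split=> //; rewrite ?e// -e.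
Qed.

(** A [nu]-null set carries no integral of [w] against [mu]. *)
Lemma ae_density w (P : T -> Prop) : has_density nu mu w ->
  {ae nu, forall x, P x} -> {ae mu, forall x, (0 < w x)%R -> P x}.
Proof.
move=> hw [N [mN N0 PN]]; have [mw w0 h] := hw.
have /(integrableS measurableT mN (@subsetT _ _)) iw :=
  has_density_integrable hw.
have : ae_eq mu N (EFin \o w) (cst 0).
  apply/ae_eq_integral_abs => //; first exact: measurable_int iw.
  by under eq_integral do rewrite /= ger0_norm//; rewrite -h.
apply: filterS => x /= + wx; apply: contraPP => nP /(_ (PN _ nP)) [w0'].
by rewrite w0' ltxx in wx.
Qed.

Lemma density_gt0_ae w : has_density nu mu w ->
  {ae nu, forall x, (0 < w x)%R}.
Proof.
move=> [mw w0 h].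
have mw0 : measurable (w @^-1` [set 0%R]) by rewrite -[X in measurable X]setTI; apply: mw.
exists (w @^-1` [set 0%R]); split=> //.
- by rewrite h//; apply: integral0_eq => x /= ->.
- by move=> x /= /negP; rewrite lt_neqAle w0 andbT negbK => /eqP.
Qed.

End one_density.

(** On the set where the inequality fails, the difference of the two sides is
    positive and has a nonpositive integral. *)
Lemma has_density_le (nu nu' mu : {finite_measure set T -> \bar R}) (w w' : T -> R)
    (c c' : R) :
  has_density nu mu w -> has_density nu' mu w' -> (0 <= c)%R -> (0 <= c')%R ->
  (forall A, measurable A -> c%:E * nu A <= c'%:E * nu' A) ->
  {ae mu, forall x, (c * w x <= c' * w' x)%R}.
Proof.
move=> hw hw' c0 c0' le.
have iw := has_density_integrable hw.
have iw' := has_density_integrable hw'.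
move: hw hw' => [mw w0 h] [mw' w0' h'].
pose E := [set x | (c' * w' x < c * w x)%R].
have mE : measurable E.
  have : measurable_fun setT (fun x => c' * w' x < c * w x)%R.
    by apply: measurable_fun_ltr; exact: measurable_funM.
  by move=> /(_ measurableT [set true]); rewrite setTI; exact.
have iE (v : T -> R) b : mu.-integrable setT (EFin \o v) ->
    mu.-integrable E (fun x => (b * v x)%:E).
  move=> iv; apply: (integrableS measurableT) => //.
  exact: (integrableZl measurableT b iv).
have : ae_eq mu E (fun x => (c * w x)%:E - (c' * w' x)%:E) (cst 0).
  apply/ae_eq_integral_abs => //.
    by apply: measurable_int (integrableB mE (iE _ _ iw) (iE _ _ iw')).
  apply/eqP; rewrite eq_le integral_ge0 ?andbT//.
  rewrite (eq_integral (fun x => (c * w x)%:E - (c' * w' x)%:E)); last first.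
    move=> x; rewrite inE => Ex; rewrite gee0_abs//.
    by rewrite -EFinB lee_fin subr_ge0 ltW.
  rewrite integralB//; [|exact: iE..].
  have eqn (v : T -> R) b : (0 <= b)%R -> measurable_fun setT v ->
      (forall x, (0 <= v x)%R) -> \int[mu]_(x in E) (b * v x)%:E =
      b%:E * \int[mu]_(x in E) (v x)%:E.
    move=> b0 mv v0; under eq_integral do rewrite EFinM.
    rewrite ge0_integralZl_EFin//; first by move=> x _; rewrite lee_fin.
    exact/measurable_EFinP/measurable_funTS.
  rewrite !eqn// -h// -h'// leeBlDr ?add0e//; first exact: le.
  by rewrite fin_numM// fin_num_measure.
apply: filterS => x /= h1; rewrite leNgt; apply/negP => Ex.
by have [/eqP] := h1 Ex; rewrite gt_eqF// subr_gt0.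
Qed.

End density.

(** * Relative entropy *)

Section entropy_function.
Context (R : realType).

Definition entropy (s : R) : R := s * ln s - s + 1.

Lemma ln_le_subr1 (x : R) : 0 < x -> ln x <= x - 1.
Proof.
by move=> x0; have := @le_ln1Dx R (x - 1); rewrite addrCA subrr addr0; apply; lra.
Qed.

Lemma entropy_ge0 (s : R) : 0 <= s -> 0 <= entropy s.
Proof.
rewrite /entropy le_eqVlt => /predU1P[<-|s0]; first by rewrite mul0r; lra.
have := @ln_le_subr1 (s^-1); rewrite invr_gt0 lnV ?posrE// => /(_ s0) h.
have : s * (- ln s) <= s * (s^-1 - 1) by rewrite ler_wpM2l// ltW.
by rewrite mulrBr divff ?gt_eqF//; lra.
Qed.

Lemma mulln_geN1 (s : R) : 0 <= s -> -1 <= s * ln s.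
Proof. by move=> s0; have := entropy_ge0 s0; rewrite /entropy; lra. Qed.

(** The tangent line of the convex entropy at [b] gives the bound with [ln b] in
    place of [ln (l * a)], and [ln b] is then moved to [ln (l * a)] in the
    direction that increases the product with [b - a].  The bound is useful
    because its right-hand side is affine in [b]: integrated, it involves the
    perturbed measure and not the perturbed density.  At [a = 0] it holds
    because [b] vanishes too. *)
Lemma entropy_increment (a b l : R) : 0 <= a -> 0 < l ->
  (1 <= l /\ a <= b <= l * a) \/ (l <= 1 /\ l * a <= b <= a) ->
  entropy b <= entropy a + (ln l + ln a) * (b - a).
Proof.
rewrite le_eqVlt => /predU1P[<-|a0] l0 ab.
  have -> : b = 0 by apply/eqP; rewrite eq_le; case: ab; rewrite mulr0; lra.
  by rewrite subrr mulr0 addr0.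
have la0 : 0 < l * a by rewrite mulr_gt0.
have b0 : 0 < b.
  by case: ab => -[_ /andP[h _]]; [exact: lt_le_trans h|exact: lt_le_trans h].
rewrite -lnM ?posrE//.
apply: (@le_trans _ _ (entropy a + ln b * (b - a))).
  have := @ln_le_subr1 (b / a); rewrite divr_gt0// ln_div ?posrE// => /(_ isT) h.
  have : a * (ln b - ln a) <= a * (b / a - 1) by rewrite ler_wpM2l// ltW.
  have -> : a * (b / a - 1) = b - a by field; rewrite gt_eqF.
  by rewrite /entropy; lra.
rewrite lerD2l; case: ab => -[_ /andP[h1 h2]].
  by rewrite ler_wpM2r ?subr_ge0// ler_ln.
by rewrite ler_wnM2r ?subr_le0// ler_ln.
Qed.

Lemma measurable_entropy : measurable_fun setT entropy.
Proof.
apply: measurable_funD => //; apply: measurable_funB => //.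
by apply: measurable_funM => //; exact: measurable_ln.
Qed.

End entropy_function.

Section relative_entropy.
Context d (T : measurableType d) (R : realType).
Local Open Scope ereal_scope.

Lemma measurable_EFin_ln (w : T -> R) : measurable_fun setT w ->
  measurable_fun setT (fun x => (ln (w x))%:E).
Proof.
move=> mw; apply/measurable_EFinP.
by apply: measurableT_comp => //; exact: measurable_ln.
Qed.

Lemma measurable_lne_EFin (w : T -> R) : measurable_fun setT w ->
  measurable_fun setT (fun x => lne (w x)%:E).
Proof.
move=> mw.
apply: measurable_fun_ifT => //.
  exact: measurable_fun_ler.
exact: measurable_EFin_ln.
Qed.

(** The integral defining [KL] has an integrand of variable sign.  Since
    [s ln s >= -1], its negative part has a finite integral, so that it can be
    rearranged into the integral of a nonnegative function, for which an infinite
    value of [KL] raises no difficulty. *)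
Lemma KLE (rho mu : {finite_measure set T -> \bar R}) (r : T -> R) :
  has_density rho mu r -> KL rho mu = \int[mu]_x (entropy (r x))%:E.
Proof.
move=> hr; have rhomu := has_density_dominates hr.
have [mr r0 hrA] := hr.
have mlnr := measurable_EFin_ln mr.
rewrite /KL asboolT//.
have rmu := density_ae hr.
have -> : \int[rho]_x lne (density rho mu x) = \int[rho]_x (ln (r x))%:E.
  apply: ae_eq_integral => //.
    have dE x : density rho mu x = (fine (density rho mu x))%:E.
      by rewrite fineK//; exact: Radon_Nikodym_fin_num.
    apply: (eq_measurable_fun (fun x => lne (fine (density rho mu x))%:E)).
      by move=> x _; rewrite -dE.
    apply: measurable_lne_EFin; apply: measurableT_comp => //.
    by apply: measurable_int; exact: Radon_Nikodym_integrable.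
  have rrho : {ae rho, forall x, density rho mu x = (r x)%:E}.
    move: rmu => [N [mN N0 rN]]; exists N; split => //.
    by move/null_content_dominatesP : rhomu; exact.
  apply: filterS2 rrho (density_gt0_ae hr) => x /= -> rx _.
  by rewrite lne_EFin.
rewrite (integral_density hr)//.
pose phi x := (r x * ln (r x))%R.
have mphi : measurable_fun setT phi.
  by apply: measurable_funM => //; exact/measurable_EFinP.
under eq_integral do rewrite -EFinM mulrC -/(phi _).
have rhoT : rho setT = \int[mu]_x (r x)%:E by exact: hrA.
have muT : mu setT = \int[mu]_x (cst 1 x) by rewrite integral_cst// mul1e.
have N : \int[mu]_x (EFin \o phi)^\- x \is a fin_num.
  rewrite ge0_fin_numE; last exact: integral_ge0.
  apply: (@le_lt_trans _ _ (\int[mu]_x (cst 1 x))).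
    apply: ge0_le_integral => //; first exact/measurable_funeneg/measurable_EFinP.
    move=> x _; rewrite funenegE /= -EFin_max lee_fin ge_max ler01 andbT.
    by rewrite lerNl mulln_geN1.
  by rewrite -muT ltey_eq fin_num_measure.
have E : \int[mu]_x (entropy (r x))%:E + \int[mu]_x (EFin \o phi)^\- x + rho setT
    = \int[mu]_x (EFin \o phi)^\+ x + mu setT.
  have me : measurable_fun setT (fun x => (entropy (r x))%:E).
    by apply/measurable_EFinP; apply: measurableT_comp => //; exact: measurable_entropy.
  have e0 x : 0 <= (entropy (r x))%:E by rewrite lee_fin entropy_ge0.
  have mn := measurable_funeneg ((measurable_EFinP _ _).2 mphi).
  have mp := measurable_funepos ((measurable_EFinP _ _).2 mphi).
  rewrite rhoT muT -[in LHS]ge0_integralD// -[in LHS]ge0_integralD//; last 4 first.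
  - by move=> x _; rewrite adde_ge0.
  - exact: emeasurable_funD.
  - by move=> x _; rewrite lee_fin.
  - exact/measurable_EFinP.
  rewrite -[in RHS]ge0_integralD//.
  apply: eq_integral => x _; rewrite funenegE funeposE /= -!EFin_max -!EFinD.
  congr (_%:E); rewrite /entropy -/(phi x).
  by case: (leP (phi x) 0%R) => h; rewrite maxC; case: ltP; lra.
rewrite integralE.
have e0 : 0 <= \int[mu]_x (entropy (r x))%:E.
  by apply: integral_ge0 => x _; rewrite lee_fin entropy_ge0.
have p0 : 0 <= \int[mu]_x (EFin \o phi)^\+ x by exact: integral_ge0.
move: E; rewrite -(fineK N) -(fineK (fin_num_measure mu _ measurableT)).
rewrite -(fineK (fin_num_measure rho _ measurableT)).
move: e0 p0; case: (\int[mu]_x (entropy (r x))%:E) => [e| |]//;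
  case: (\int[mu]_x (EFin \o phi)^\+ x) => [p| |]// _ _ /= [h].
by congr (_%:E); lra.
Qed.

Lemma KL_ge0 (rho mu : {finite_measure set T -> \bar R}) : 0 <= KL rho mu.
Proof.
have [rhomu|nrhomu] := pselect (rho `<< mu); last by rewrite /KL asboolF ?leey.
rewrite (KLE (has_density_dominated rhomu)).
apply: integral_ge0 => x _; rewrite lee_fin entropy_ge0//=.
by rewrite fine_ge0// Radon_Nikodym_SigmaFinite.f_ge0.
Qed.

Lemma KL_lty_dominated (rho mu : {finite_measure set T -> \bar R}) :
  KL rho mu < +oo -> rho `<< mu.
Proof. by rewrite /KL; case: asboolP. Qed.

Lemma integrable_entropy (rho mu : {finite_measure set T -> \bar R}) (r : T -> R) :
  has_density rho mu r -> KL rho mu < +oo ->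
  mu.-integrable setT (fun x => (entropy (r x))%:E).
Proof.
move=> hr; rewrite (KLE hr) => h; have [mr r0 _] := hr.
apply/integrableP; split.
  by apply/measurable_EFinP; apply: measurableT_comp => //; exact: measurable_entropy.
by under eq_integral do rewrite /= ger0_norm ?entropy_ge0//.
Qed.

Lemma integrable_ln_density (rho mu : {finite_measure set T -> \bar R}) (r : T -> R) :
  has_density rho mu r -> KL rho mu < +oo ->
  rho.-integrable setT (fun x => (ln (r x))%:E).
Proof.
move=> hr h; have ie := integrable_entropy hr h; have [mr r0 _] := hr.
have mlnr := measurable_EFin_ln mr.
apply/(integrable_densityP hr mlnr).
have i1 : mu.-integrable setT (cst 1) by exact: finite_measure_integrable_cst.
have ir := has_density_integrable hr.
have := integrableD measurableT ie (integrableB measurableT ir i1).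
apply: eq_integrable => // x _ /=.
by rewrite -EFinM -EFinB -EFinD; congr (_%:E); rewrite /entropy; ring.
Qed.

Lemma KL_integral_ln (rho mu : {finite_measure set T -> \bar R}) (r : T -> R) :
  has_density rho mu r -> KL rho mu < +oo ->
  KL rho mu = \int[rho]_x (ln (r x))%:E - rho setT + mu setT.
Proof.
move=> hr KLfin; rewrite (KLE hr); have [mr r_ge0 rE] := hr.
have ilnr := integrable_ln_density hr KLfin.
have mlnr := measurable_int _ ilnr.
have i := (integrable_densityP hr mlnr).1 ilnr.
have ir := has_density_integrable hr.
have ic : mu.-integrable setT (cst 1) by exact: finite_measure_integrable_cst.
rewrite (integral_density hr mlnr) rE//.
have -> : mu setT = \int[mu]_x (cst 1 x) by rewrite integral_cst// mul1e.
rewrite -integralB// -integralD//; last exact: integrableB.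
by apply: eq_integral => x _ /=; rewrite /entropy mulrC.
Qed.

(** The integrated form of [entropy_increment]: a measure squeezed between [rho]
    and [l * rho] has a relative entropy bounded to first order by the integral
    of the logarithmic density of [rho]. *)
Lemma KL_increment (rho rho' mu : {finite_measure set T -> \bar R}) (r : T -> R)
    (l : R) :
  has_density rho mu r -> KL rho mu < +oo -> (0 < l)%R ->
  ((1 <= l)%R /\ forall A, measurable A ->
     rho A <= rho' A /\ rho' A <= l%:E * rho A) \/
  ((l <= 1)%R /\ forall A, measurable A ->
     l%:E * rho A <= rho' A /\ rho' A <= rho A) ->
  rho'.-integrable setT (fun x => (ln l + ln (r x))%:E) ->
  KL rho' mu <= KL rho mu +
    (\int[rho']_x (ln l + ln (r x))%:E - \int[rho]_x (ln l + ln (r x))%:E).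
Proof.
move=> hr h l0 le if'; have [mr r0 _] := hr.
have ilr := integrable_ln_density hr h.
pose f x := (ln l + ln (r x))%:E.
have if_ : rho.-integrable setT f.
  have ic : rho.-integrable setT (cst (ln l)%:E).
    exact: finite_measure_integrable_cst.
  by have := integrableD measurableT ic ilr; apply: eq_integrable.
have mf := measurable_int _ if_.
have rho'mu : rho' `<< mu.
  apply/null_content_dominatesP => A mA A0.
  have := has_density_dominates hr.
  move=> /null_content_dominatesP/(_ A mA A0) rA.
  apply/eqP; rewrite eq_le measure_ge0 andbT.
  by case: le => -[_ /(_ A mA)[_]]; rewrite rA ?mule0.
have := has_density_dominated rho'mu.
set r' := fine \o _ => hr'.
have [mr' r'0 _] := hr'.
rewrite (KLE hr') (KLE hr).
rewrite (integral_density hr mf) (integral_density hr' mf).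
have ifr := (integrable_densityP hr mf).1 if_.
have ifr' := (integrable_densityP hr' mf).1 if'.
have ie := integrable_entropy hr h.
have ig := integrableD measurableT ie (integrableB measurableT ifr' ifr).
rewrite -integralB// -integralD//; last exact: integrableB.
have ae1 : {ae mu, forall x, ((1 <= l)%R /\ r x <= r' x <= l * r x)%R \/
    ((l <= 1)%R /\ (l * r x <= r' x <= r x)%R)}.
  case: le => -[l1 le].
    have h1 : {ae mu, forall x, (1 * r x <= 1 * r' x)%R}.
      apply: (has_density_le hr hr') => // A mA.
      by rewrite !mul1e; apply: (le A mA).1.
    have h2 : {ae mu, forall x, (1 * r' x <= l * r x)%R}.
      apply: (has_density_le hr' hr) => //; first exact: ltW.
      by move=> A mA; rewrite mul1e; apply: (le A mA).2.
    apply: filterS2 h1 h2 => x; rewrite !mul1r => h1 h2; left; split=> //.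
    by rewrite h1.
  have h1 : {ae mu, forall x, (1 * r' x <= 1 * r x)%R}.
    apply: (has_density_le hr' hr) => // A mA.
    by rewrite !mul1e; apply: (le A mA).2.
  have h2 : {ae mu, forall x, (l * r x <= 1 * r' x)%R}.
    apply: (has_density_le hr hr') => //; first exact: ltW.
    by move=> A mA; rewrite mul1e; apply: (le A mA).1.
  apply: filterS2 h1 h2 => x; rewrite !mul1r => h1 h2; right; split=> //.
  by rewrite h1 h2.
set g := (X in _ <= \int[mu]_x X x).
have ae2 : {ae mu, forall x, (entropy (r' x))%:E <= g x}.
  apply: filterS ae1 => x /(entropy_increment (r0 x) l0) hx.
  rewrite /g /f /= -!EFinM -EFinB -EFinD lee_fin (le_trans hx)//.
  by rewrite mulrBr.
have mg := measurable_int _ ig.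
(* [g] is nonnegative only almost everywhere, whereas integrals are compared
   below for functions that are nonnegative everywhere *)
have gp : \int[mu]_x g x = \int[mu]_x g^\+ x.
  apply: ae_eq_integral => //; first exact: measurable_funepos.
  apply: filterS ae2 => x hx _; rewrite funeposE; apply/esym/max_idPl.
  by rewrite (le_trans _ hx)// lee_fin entropy_ge0.
rewrite gp; apply: ae_ge0_le_integral => //.
- by move=> x _; rewrite lee_fin entropy_ge0.
- by apply/measurable_EFinP; apply: measurableT_comp => //; exact: measurable_entropy.
- exact: measurable_funepos.
by apply: filterS ae2 => x hx _; rewrite (le_trans hx)// funeposE le_max lexx.
Qed.

End relative_entropy.

(** * First-order optimality of entropic transport plans *)

Section reweight.
Context d (T : measurableType d) (R : realType).
Variables (mu : {finite_measure set T -> \bar R}) (A : set T).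
Hypothesis mA : measurable A.
Variable (l : {nonneg R}).
Local Open Scope ereal_scope.

(** The competitors used in the first variation: mass is multiplied by [l] on
    [A] only. *)
Definition reweight :=
  measure_add (mscale l (mrestr mu mA)) (mrestr mu (measurableC mA)).

HB.instance Definition _ := Measure.on reweight.

Lemma reweightE B : reweight B = l%:num%:E * mu (B `&` A) + mu (B `&` ~` A).
Proof. by rewrite /reweight measure_addE. Qed.

Let reweight_fin : fin_num_fun reweight.
Proof.
move=> B mB; rewrite reweightE fin_numD fin_numM ?fin_num_measure//.
- by apply: measurableI => //; exact: measurableC.
- exact: measurableI.
Qed.

HB.instance Definition _ := Measure_isFinite.Build _ _ _ reweight reweight_fin.

Definition reweight_density x : R := if x \in A then l%:num else 1%R.

Let splitA (B : set T) : measurable B -> mu B = mu (B `&` A) + mu (B `&` ~` A).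
Proof.
move=> mB; rewrite -measureU -?setIUr ?setUv ?setIT//.
- exact: measurableI.
- by apply: measurableI => //; exact: measurableC.
- by rewrite -setIIr setICr setI0.
Qed.

Lemma reweight_le B : measurable B -> (1 <= l%:num)%R ->
  mu B <= reweight B /\ reweight B <= l%:num%:E * mu B.
Proof.
move=> mB l1; have mAC := measurableC mA.
rewrite reweightE (splitA mB); split.
  by rewrite leeD2r// lee_pemull// lee_fin.
rewrite ge0_muleDr// leeD2l// ?lee_pemull// lee_fin.
Qed.

Lemma reweight_ge B : measurable B -> (l%:num <= 1)%R ->
  l%:num%:E * mu B <= reweight B /\ reweight B <= mu B.
Proof.
move=> mB l1; have mAC := measurableC mA.
rewrite reweightE (splitA mB); split.
  by rewrite ge0_muleDr// leeD2l// gee_pMl// ?lee_fin// fin_num_measure//; exact: measurableI.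
rewrite leeD2r// gee_pMl// ?lee_fin// fin_num_measure//; exact: measurableI.
Qed.

Lemma has_density_reweight : has_density reweight mu reweight_density.
Proof.
have mAC := measurableC mA.
have mw : measurable_fun setT reweight_density.
  apply: measurable_fun_ifT => //.
  by apply: (measurable_fun_bool true); rewrite setTI preimage_mem_true.
split => // [x|B mB]; first by rewrite /reweight_density; case: ifP.
have w0 x : 0 <= (reweight_density x)%:E.
  by rewrite lee_fin /reweight_density; case: ifP.
have mBA : measurable (B `&` A) by exact: measurableI.
have mBAC : measurable (B `&` ~` A) by exact: measurableI.
rewrite [LHS]reweightE -[in RHS](setIT B) -(setUv A) setIUr ge0_integral_setU//; last 2 first.
- by apply/measurable_EFinP; apply: measurable_funTS.
- by apply/disj_set2P; rewrite -setIIr setICr setI0.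
congr (_ + _).
  rewrite (eq_integral (cst l%:num%:E)) ?integral_cst// => x.
  by rewrite inE /reweight_density => -[_ Ax]; rewrite mem_set.
rewrite (eq_integral (cst 1)) ?integral_cst ?mul1e// => x.
by rewrite inE /reweight_density => -[_ Ax]; rewrite memNset.
Qed.

Lemma integrable_reweight (h : T -> \bar R) : mu.-integrable setT h ->
  reweight.-integrable setT h.
Proof.
move=> ih; have mh := measurable_int _ ih.
apply/(integrable_densityP has_density_reweight mh).
have [mw w0 _] := has_density_reweight.
have ih' := integrableZl measurableT (Num.max 1 l%:num)%R ih.
apply: le_integrable ih' => //.
  by apply: emeasurable_funM => //; exact/measurable_EFinP.
move=> x _ /=; rewrite muleC !abseM lee_wpmul2r//=.
rewrite lee_fin (ger0_norm (w0 x)) ger0_norm; last by rewrite le_max ler01.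
by rewrite /reweight_density; case: ifP; rewrite le_max lexx ?orbT.
Qed.

Lemma integral_reweight (h : T -> \bar R) : mu.-integrable setT h ->
  \int[reweight]_x h x = \int[mu]_x h x + (l%:num - 1)%:E * \int[mu]_(x in A) h x.
Proof.
move=> ih; have mh := measurable_int _ ih.
have mAC := measurableC mA.
have iA := integrableS measurableT mA (@subsetT _ _) ih.
have iAC := integrableS measurableT mAC (@subsetT _ _) ih.
have irw := integrable_reweight ih.
have split_ (k : T -> \bar R) : mu.-integrable setT k ->
   \int[mu]_x k x = \int[mu]_(x in A) k x + \int[mu]_(x in ~` A) k x.
  move=> ik; have mk := measurable_int _ ik.
  rewrite -(setUv A) integral_setU//; first by rewrite setUv.
  by apply/disj_set2P; rewrite setICr.
rewrite (integral_density has_density_reweight mh) split_; last first.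
  by apply/(integrable_densityP has_density_reweight mh).
rewrite (split_ h ih).
have -> : \int[mu]_(x in A) (h x * (reweight_density x)%:E) =
    l%:num%:E * \int[mu]_(x in A) h x.
  rewrite -integralZl//; apply: eq_integral => x xA.
  by rewrite /reweight_density xA muleC.
have -> : \int[mu]_(x in ~` A) (h x * (reweight_density x)%:E) =
    \int[mu]_(x in ~` A) h x.
  apply: eq_integral => x; rewrite inE => xA.
  by rewrite /reweight_density memNset// mule1.
rewrite -(fineK (integrable_fin_num mA iA)) -(fineK (integrable_fin_num mAC iAC)).
by rewrite -!EFinM -!EFinD; congr (_%:E); ring.
Qed.

End reweight.

Section marginal_integration.
Context d1 d2 (T1 : measurableType d1) (T2 : measurableType d2) (R : realType).
Local Open Scope ereal_scope.
Variable plan : {finite_measure set (T1 * T2)%type -> \bar R}.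

Lemma integrable_marginal0 (f : T1 -> \bar R) : measurable_fun setT f ->
  (marginal0 plan).-integrable setT f <-> plan.-integrable setT (f \o fst).
Proof.
move=> mf; split; last first.
  by move=> h; apply: integrable_pushforward.
move=> /integrableP[_ h]; apply/integrableP; split; first exact: measurableT_comp.
move: h; rewrite ge0_integral_pushforward//; exact: measurableT_comp.
Qed.

Lemma integrable_marginal1 (f : T2 -> \bar R) : measurable_fun setT f ->
  (marginal1 plan).-integrable setT f <-> plan.-integrable setT (f \o snd).
Proof.
move=> mf; split; last first.
  by move=> h; apply: integrable_pushforward.
move=> /integrableP[_ h]; apply/integrableP; split; first exact: measurableT_comp.
move: h; rewrite ge0_integral_pushforward//; exact: measurableT_comp.
Qed.

End marginal_integration.

Section reweight_entropy.
Context d d' (T : measurableType d) (S : measurableType d') (R : realType).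
Local Open Scope ereal_scope.

(** Stated for an arbitrary projection [p] so as to serve for both marginals. *)
Lemma KL_reweight (plan : {finite_measure set T -> \bar R}) (A : set T)
    (mA : measurable A) (l : {nonneg R}) (p : T -> S)
    (rho rho' mu : {finite_measure set S -> \bar R}) (r : S -> R) :
  measurable_fun setT p ->
  (forall B, rho B = plan (p @^-1` B)) ->
  (forall B, rho' B = reweight plan mA l (p @^-1` B)) ->
  has_density rho mu r -> KL rho mu < +oo -> (0 < l%:num)%R ->
  KL rho' mu <= KL rho mu + (l%:num - 1)%:E *
    (\int[plan]_(z in A) (ln (r (p z)))%:E + (ln l%:num)%:E * plan A).
Proof.
move=> mp rhoE rho'E hr KLfin l0; have [mr r0 _] := hr.
pose f x := (ln l%:num + ln (r x))%:E.
have mlnr := measurable_EFin_ln mr.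
have mf : measurable_fun setT f.
  apply/measurable_EFinP; apply: measurable_funD => //.
  by apply/measurable_EFinP.
have pushE (f' : S -> \bar R) (nu : {measure set T -> \bar R})
    (nu' : {measure set S -> \bar R}) : (forall B, nu' B = nu (p @^-1` B)) ->
    \int[nu']_x f' x = \int[pushforward nu p]_x f' x.
  by move=> nuE; apply: eq_measure_integral => B mB _; rewrite nuE.
have mpB B : measurable B -> measurable (p @^-1` B).
  by move=> mB; rewrite -[X in measurable X]setTI; exact: mp.
have ilnrp : plan.-integrable setT (fun z => (ln (r (p z)))%:E).
  have /integrableP[_] := integrable_ln_density hr KLfin.
  rewrite (pushE _ _ _ rhoE) ge0_integral_pushforward//; last exact: measurableT_comp.
  by move=> h; apply/integrableP; split => //; exact: measurableT_comp mlnr mp.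
have ic : plan.-integrable setT (cst (ln l%:num)%:E).
  exact: finite_measure_integrable_cst.
have ifp : plan.-integrable setT (f \o p).
  by have := integrableD measurableT ic ilnrp; apply: eq_integrable.
have ifp' := integrable_reweight mA l ifp.
have if' : rho'.-integrable setT f.
  apply/integrableP; split => //.
  rewrite (pushE _ _ _ rho'E) ge0_integral_pushforward//; last exact: measurableT_comp.
  by case/integrableP : ifp'.
apply: (le_trans (KL_increment hr KLfin l0 _ if')).
  case: (lerP 1 l%:num) => [l1|/ltW l1]; [left|right]; split=> // B mB.
    by rewrite rhoE rho'E; apply: reweight_le => //; exact: mpB.
  by rewrite rhoE rho'E; apply: reweight_ge => //; exact: mpB.
rewrite leeD2l//.
rewrite -/f (pushE _ _ _ rho'E) (pushE _ _ _ rhoE) !integral_pushforward//.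
rewrite preimage_setT integral_reweight//.
have mA' := @subsetT _ A.
have -> : \int[plan]_(z in A) (f \o p) z =
    \int[plan]_(z in A) (ln (r (p z)))%:E + (ln l%:num)%:E * plan A.
  rewrite /f /=; under eq_integral do rewrite EFinD.
  rewrite integralD//; [|exact: (integrableS measurableT)..].
  by rewrite integral_cst// addeC.
by rewrite addeAC subee ?add0e// integrable_fin_num.
Qed.

End reweight_entropy.

Section optimality.
Context d1 d2 (T1 : measurableType d1) (T2 : measurableType d2) (R : realType).
Local Open Scope ereal_scope.
Variables (c : T1 * T2 -> \bar R) (k : R).
Hypotheses (mc : measurable_fun setT c) (c0 : forall z, 0 <= c z) (k0 : (0 < k)%R).
Variables (mu0 : {finite_measure set T1 -> \bar R})
  (mu1 : {finite_measure set T2 -> \bar R}).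

Definition transport_objective (plan : {finite_measure set (T1 * T2)%type -> \bar R}) :=
  \int[plan]_z c z + k%:E * KL (marginal0 plan) mu0 + k%:E * KL (marginal1 plan) mu1.

Variable plan : {finite_measure set (T1 * T2)%type -> \bar R}.
Hypothesis plan_fin : transport_objective plan < +oo.

Lemma transport_objective_lty :
  [/\ \int[plan]_z c z < +oo, KL (marginal0 plan) mu0 < +oo &
      KL (marginal1 plan) mu1 < +oo].
Proof.
have C0 : 0 <= \int[plan]_z c z by exact: integral_ge0.
have kK d (T : measurableType d) (rho mu : {finite_measure set T -> \bar R}) :
    0 <= k%:E * KL rho mu by rewrite mule_ge0 ?KL_ge0// lee_fin ltW.
have kKfin d (T : measurableType d) (rho mu : {finite_measure set T -> \bar R}) :
    k%:E * KL rho mu < +oo -> KL rho mu < +oo.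
  by case: (KL rho mu) => [s _| |_]; rewrite ?ltry ?ltNyr// gt0_muley ?lte_fin.
split; [|apply: kKfin|apply: kKfin]; apply: le_lt_trans plan_fin.
- by rewrite /transport_objective -addeA leeDl// adde_ge0.
- by rewrite /transport_objective -addeA addeCA leeDl// adde_ge0.
- by rewrite /transport_objective leeDr// adde_ge0.
Qed.

Variables (r0 : T1 -> R) (r1 : T2 -> R).
Hypotheses (hr0 : has_density (marginal0 plan) mu0 r0)
  (hr1 : has_density (marginal1 plan) mu1 r1).

Lemma integrable_cost : plan.-integrable setT c.
Proof.
have [h _ _] := transport_objective_lty; apply/integrableP; split => //.
by under eq_integral do rewrite gee0_abs//.
Qed.

Lemma integrable_ln_density0 : plan.-integrable setT (fun z => (ln (r0 z.1))%:E).
Proof.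
have [_ h _] := transport_objective_lty; have [mr _ _] := hr0.
have mlnr := measurable_EFin_ln mr.
by have /(integrable_marginal0 _ mlnr) := integrable_ln_density hr0 h.
Qed.

Lemma integrable_ln_density1 : plan.-integrable setT (fun z => (ln (r1 z.2))%:E).
Proof.
have [_ _ h] := transport_objective_lty; have [mr _ _] := hr1.
have mlnr := measurable_EFin_ln mr.
by have /(integrable_marginal1 _ mlnr) := integrable_ln_density hr1 h.
Qed.

Hypothesis plan_min : forall plan', transport_objective plan <= transport_objective plan'.

(** The sign of [l - 1] is the sign of the variation, and [ln l] tends to [0]
    with [l - 1]: the values [l > 1] give [0 <= G] and the values [l < 1] give
    [G <= 0]. *)
Lemma eq0_of_first_variation (G P : R) : (0 <= P)%R ->
  (forall l : R, 0 < l -> 0 <= (l - 1) * (G + 2 * k * ln l * P))%R -> G = 0%R.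
Proof.
move=> P0 h; apply/eqP; rewrite eq_le; apply/andP; split.
  apply/ler_addgt0Pl => e e0; rewrite addr0.
  (* [l = (1 + s)^-1] satisfies [- ln l <= s], and [s] is so small that
     [2 k P s <= e] *)
  pose s := (e / (e + 2 * k * P + 1))%R.
  have D0 : (0 < e + 2 * k * P + 1)%R.
    by rewrite ltr_wpDl// addr_ge0 ?(ltW e0)// mulr_ge0// mulr_ge0// ltW.
  have s0 : (0 < s)%R by rewrite divr_gt0.
  have l0 : (0 < (1 + s)^-1)%R by rewrite invr_gt0; lra.
  have := h _ l0; rewrite lnV ?posrE; last lra.
  have -> : ((1 + s)^-1 - 1 = - (s / (1 + s)))%R by field; lra.
  have ln1s : (ln (1 + s) <= s)%R by apply: le_ln1Dx; lra.
  rewrite mulNr oppr_ge0 pmulr_rle0; last by rewrite divr_gt0//; lra.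
  have kP : (0 <= 2 * k * P)%R by rewrite mulr_ge0// mulr_ge0// ltW.
  have h1 : (2 * k * P * ln (1 + s) <= 2 * k * P * s)%R by rewrite ler_wpM2l.
  have h2 : (2 * k * P * s <= e)%R.
    by rewrite /s mulrA ler_pdivrMr// mulrC ler_pM2l//; lra.
  lra.
apply/ler_addgt0Pl => e e0; rewrite addrC.
pose s := (e / (2 * k * P + 1))%R.
have kP : (0 <= 2 * k * P)%R by rewrite mulr_ge0// mulr_ge0// ltW.
have s0 : (0 < s)%R by rewrite divr_gt0//; lra.
have l0 : (0 < 1 + s)%R by lra.
have := h _ l0; rewrite (_ : 1 + s - 1 = s)%R; last by ring.
rewrite pmulr_rge0//.
have ln1s : (ln (1 + s) <= s)%R by apply: le_ln1Dx; lra.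
have h1 : (2 * k * P * ln (1 + s) <= 2 * k * P * s)%R by rewrite ler_wpM2l.
have h2 : (2 * k * P * s <= e)%R.
  by rewrite /s mulrA ler_pdivrMr ?ltr_wpDl// mulrC ler_pM2l//; lra.
lra.
Qed.

(** The plan reweighted by [l] on [A] is a competitor, and [KL_reweight] bounds
    its objective by that of [plan] plus [l - 1] times the integral below, up to
    an error [2 k (l - 1) (ln l) plan(A)] of second order. *)
Lemma first_variation (A : set (T1 * T2)) : measurable A ->
  \int[plan]_(z in A) (c z + (k * (ln (r0 z.1) + ln (r1 z.2)))%:E) = 0.
Proof.
move=> mA; have iA (f : T1 * T2 -> \bar R) : plan.-integrable setT f -> plan.-integrable A f.
  exact: integrableS.
have ic := iA _ integrable_cost.
have i0 := iA _ integrable_ln_density0.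
have i1 := iA _ integrable_ln_density1.
have -> : \int[plan]_(z in A) (c z + (k * (ln (r0 z.1) + ln (r1 z.2)))%:E) =
    \int[plan]_(z in A) c z + k%:E * (\int[plan]_(z in A) (ln (r0 z.1))%:E +
       \int[plan]_(z in A) (ln (r1 z.2))%:E).
  have i01 := integrableD mA i0 i1.
  rewrite -[in RHS]integralD// -[in RHS]integralZl// -[in RHS]integralD//.
  exact: integrableZl.
have [fC fK0 fK1] := transport_objective_lty.
have Cfin := integrable_fin_num mA ic.
have L0fin := integrable_fin_num mA i0.
have L1fin := integrable_fin_num mA i1.
have Pfin := fin_num_measure plan A mA.
have ITfin := integrable_fin_num measurableT integrable_cost.
have K0fin : KL (marginal0 plan) mu0 \is a fin_num by rewrite ge0_fin_numE ?KL_ge0.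
have K1fin : KL (marginal1 plan) mu1 \is a fin_num by rewrite ge0_fin_numE ?KL_ge0.
have variation (l : R) : (0 < l)%R -> 0 <= (l - 1)%:E *
    (\int[plan]_(z in A) c z + k%:E * (\int[plan]_(z in A) (ln (r0 z.1))%:E +
       \int[plan]_(z in A) (ln (r1 z.2))%:E) + (2 * k * ln l)%:E * plan A).
  move=> l0; pose nl := NngNum (ltW l0).
  have := plan_min (reweight plan mA nl); rewrite /transport_objective.
  rewrite (integral_reweight _ _ integrable_cost) /=.
  have := @KL_reweight _ _ _ _ _ plan A mA nl fst (marginal0 plan)
    (marginal0 (reweight plan mA nl)) mu0 r0 measurable_fst
    (fun=> erefl) (fun=> erefl) hr0 fK0 l0.
  have := @KL_reweight _ _ _ _ _ plan A mA nl snd (marginal1 plan)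
    (marginal1 (reweight plan mA nl)) mu1 r1 measurable_snd
    (fun=> erefl) (fun=> erefl) hr1 fK1 l0.
  have := KL_ge0 (marginal0 (reweight plan mA nl)) mu0.
  have := KL_ge0 (marginal1 (reweight plan mA nl)) mu1.
  rewrite /= -(fineK Cfin) -(fineK L0fin) -(fineK L1fin) -(fineK Pfin).
  rewrite -(fineK ITfin) -(fineK K0fin) -(fineK K1fin).
  case: (KL (marginal0 (reweight plan mA nl)) mu0) => [K0| |]//;
  case: (KL (marginal1 (reweight plan mA nl)) mu1) => [K1| |]//.
  rewrite -!(EFinM, EFinD) !lee_fin => _ _ h1 h0 h.
  have := ler_wpM2l (ltW k0) h1; have := ler_wpM2l (ltW k0) h0.
  lra.
rewrite -(fineK Cfin) -(fineK L0fin) -(fineK L1fin) -!(EFinM, EFinD); congr (_%:E).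
apply: (@eq0_of_first_variation _ (fine (plan A))); first by rewrite fine_ge0.
move=> l /variation; rewrite -(fineK Cfin) -(fineK L0fin) -(fineK L1fin) -(fineK Pfin).
by rewrite -!(EFinM, EFinD) lee_fin.
Qed.

(** The Euler-Lagrange equation of the soft-marginal problem. *)
Lemma optimality_condition :
  {ae plan, forall z, c z = (- (k * (ln (r0 z.1) + ln (r1 z.2))))%:E}.
Proof.
have ig : plan.-integrable setT (fun z => c z + (k * (ln (r0 z.1) + ln (r1 z.2)))%:E).
  have := integrableZl measurableT k
    (integrableD measurableT integrable_ln_density0 integrable_ln_density1).
  exact: (integrableD measurableT integrable_cost).
have : ae_eq plan setT (fun z => c z + (k * (ln (r0 z.1) + ln (r1 z.2)))%:E) (cst 0).
  apply: integral_ae_eq => // E _ mE; rewrite first_variation//.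
  by rewrite integral0_eq.
apply: filterS => z /(_ I) /=; case: (c z) => [s| |]//= -[h].
by congr (_%:E); lra.
Qed.

(** By [first_variation] on the whole space, the cost cancels against the
    logarithmic parts of both relative entropies: only masses are left. *)
Lemma transport_objective_optimal : transport_objective plan =
  k%:E * (mu0 setT + mu1 setT) - (2 * k)%:E * plan setT.
Proof.
have [fC fK0 fK1] := transport_objective_lty.
have i0 := integrable_ln_density0; have i1 := integrable_ln_density1.
have [mr0 r00 r0E] := hr0; have [mr1 r10 r1E] := hr1.
have mln0 := measurable_EFin_ln mr0.
have mln1 := measurable_EFin_ln mr1.
rewrite /transport_objective (KL_integral_ln hr0 fK0) (KL_integral_ln hr1 fK1).
rewrite !integral_pushforward// preimage_setT.
have := first_variation measurableT.
rewrite integralD//; last 2 first.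
- exact: integrable_cost.
- exact: (integrableZl measurableT k (integrableD measurableT i0 i1)).
under [X in _ + X]eq_integral do rewrite EFinM EFinD.
rewrite integralZl//; last exact: integrableD.
rewrite integralD//.
rewrite -[X in _ - X + mu0 _](_ : plan setT = _)// -[X in _ - X + mu1 _](_ : plan setT = _)//.
have Cfin := integrable_fin_num measurableT integrable_cost.
have L0fin := integrable_fin_num measurableT i0.
have L1fin := integrable_fin_num measurableT i1.
rewrite /= -(fineK Cfin) -(fineK L0fin) -(fineK L1fin).
rewrite -(fineK (fin_num_measure plan _ measurableT)).
rewrite -(fineK (fin_num_measure mu0 _ measurableT)).
rewrite -(fineK (fin_num_measure mu1 _ measurableT)).
rewrite -!EFinN -!(EFinM, EFinD) => -[h]; congr (_%:E).
lra.
Qed.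

End optimality.

(** * The Hellinger-Kantorovich cost *)

Section metric_measurability.
Context (R : realType) (X : pmetricType R).

(** The product of the Borel sigma-algebras contains the open sets of the product
    because, with a countable basis, an open set of the product is a countable
    union of open rectangles. *)
Lemma measurable_mdist : @second_countable X ->
  measurable_fun setT (fun z : borel X * borel X => mdist (z.1 : X) z.2).
Proof.
move=> [B cB [Bo Bx]].
apply: (measurability (@RGenInftyO.G R)); first exact: RGenInftyO.measurableE.
move=> _ [_ [r ->] <-]; rewrite setTI.
pose S : set (set X * set X) :=
  (B `*` B) `&` [set p | p.1 `*` p.2 `<=` [set z : X * X | mdist z.1 z.2 < r]].
have -> : (fun z : borel X * borel X => mdist (z.1 : X) z.2) @^-1` `]-oo, r[%classic =
    \bigcup_(p in S) ((p.1 : set (borel X)) `*` (p.2 : set (borel X))).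
  apply/seteqP; split => [[x y]/=|[x y] [p [_ pr] [/= px py]]]; last first.
    by rewrite in_itv; exact: (pr (x, y)).
  rewrite in_itv /= => xyr; pose e := (r - mdist (x : X) y) / 2.
  have e0 : 0 < e by rewrite divr_gt0// subr_gt0.
  have [U [BU Ux] Ue] := Bx x _ (nbhsx_ballx (x : X) _ e0).
  have [V [BV Vy] Ve] := Bx y _ (nbhsx_ballx (y : X) _ e0).
  exists (U, V) => //; split => // -[x' y'] [/= Ux' Vy'].
  move: (Ue _ Ux') (Ve _ Vy'); rewrite !ballEmdist /= => xx' yy'.
  have h1 := metric_triangle x' x y'; have h2 := metric_triangle x y y'.
  have h3 := metric_sym x' x.
  by rewrite /e in xx' yy'; rewrite h3 in h1; lra.
have cS : countable S.
  apply: (@sub_countable _ _ _ (B `*` B)); last exact: countableX.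
  by apply: subset_card_le => p [].
have mS p : S p -> measurable ((p.1 : set (borel X)) `*` (p.2 : set (borel X))).
  move=> [[B1 B2] _]; apply: measurableX; apply: sub_sigma_algebra; exact: Bo.
have [->|[f]] := pfcard_geP cS; first by rewrite bigcup_set0.
rewrite (_ : \bigcup_(p in S) _ = \bigcup_n (((f n).1 : set (borel X)) `*` ((f n).2 : set (borel X)))).
  by apply: bigcupT_measurable => n; apply: mS; exact: funS.
apply/seteqP; split => [z [p Sp pz]|z [n _ nz]]; last by exists (f n) => //; exact: funS.
by have [n _ np] := surj (f := f) Sp; exists n => //; rewrite np.
Qed.

End metric_measurability.

Section HK_cost_properties.
Context (R : realType) (X : pmetricType R) (kappa : R).
Hypothesis kappa_gt0 : 0 < kappa.
Local Open Scope ereal_scope.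

Lemma HK_angle_lt_pihalf (r : R) : (0 <= r -> r < kappa * pi / 2 ->
  - (pi / 2) < r / kappa < pi / 2)%R.
Proof.
move=> r0 rk; have pi0 := pi_gt0 R; apply/andP; split.
  by apply: (@lt_le_trans _ _ 0%R); rewrite ?oppr_lt0 ?divr_gt0// divr_ge0// ltW.
by rewrite ltr_pdivrMr// mulrC mulrA.
Qed.

Lemma HK_cost_ge0 (z : borel X * borel X) : 0 <= HK_cost kappa z.
Proof.
rewrite /HK_cost; case: ifPn => [h|_]; last exact: leey.
have ln0 : (ln (cos (mdist (z.1 : X) z.2 / kappa)) <= 0)%R.
  by apply: ln_le0; exact: cos_le1.
rewrite lee_fin !mulNr oppr_ge0; apply: mulr_ge0_le0 => //.
by rewrite mulr_ge0// sqr_ge0.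
Qed.

Lemma measurable_HK_cost : @second_countable X ->
  measurable_fun setT (@HK_cost R X kappa).
Proof.
move=> scX; have md := measurable_mdist scX.
apply: measurable_fun_ifT => //; first exact: measurable_fun_ltr.
apply/measurable_EFinP; apply: measurable_funM => //.
have m1 : measurable_fun setT (fun z : borel X * borel X => mdist (z.1 : X) z.2 / kappa)%R.
  exact: measurable_funM.
have m2 := measurableT_comp (continuous_measurable_fun (@continuous_cos R)) m1.
exact: measurableT_comp (@measurable_ln R) m2.
Qed.

Lemma HK_cost_eq_ln (z : borel X * borel X) (a b : R) : (0 < a)%R -> (0 < b)%R ->
  HK_cost kappa z = (- (kappa ^+ 2 * (ln a + ln b)))%:E ->
  [/\ (0 < cos (mdist (z.1 : X) z.2 / kappa))%R &
      (a * b = cos (mdist (z.1 : X) z.2 / kappa) ^+ 2)%R].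
Proof.
move=> a0 b0; rewrite /HK_cost; case: ifPn => // h [e].
have c0 : (0 < cos (mdist (z.1 : X) z.2 / kappa))%R.
  by apply: cos_gt0_pihalf; apply: HK_angle_lt_pihalf => //; exact: mdist_ge0.
split => //; apply: ln_inj; rewrite ?posrE ?mulr_gt0 ?exprn_gt0//.
rewrite lnXn// lnM ?posrE//.
have k0 : (kappa ^+ 2 != 0)%R by rewrite expf_neq0// gt_eqF.
apply: (mulfI k0); rewrite mulr2n; lra.
Qed.

End HK_cost_properties.

Section null_plan.
Context d1 d2 (T1 : measurableType d1) (T2 : measurableType d2) (R : realType).
Local Open Scope ereal_scope.

Lemma KL_null d (T : measurableType d) (rho mu : {finite_measure set T -> \bar R}) :
  (forall A, rho A = 0) -> KL rho mu = mu setT.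
Proof.
move=> rho0; have h : has_density rho mu (cst 0%R).
  by split => // A mA; rewrite integral0_eq//; exact: rho0.
rewrite (KLE h) (eq_integral (cst 1)) ?integral_cst ?mul1e// => x _.
by rewrite /entropy mul0r subr0 add0r.
Qed.

Lemma transport_objective_null (c : T1 * T2 -> \bar R) (k : R)
  (mu0 : {finite_measure set T1 -> \bar R})
  (mu1 : {finite_measure set T2 -> \bar R})
  (plan : {finite_measure set (T1 * T2)%type -> \bar R}) :
  (forall A, plan A = 0) ->
  transport_objective c k mu0 mu1 plan = k%:E * mu0 setT + k%:E * mu1 setT.
Proof.
move=> p0; rewrite /transport_objective !KL_null; [|by move=> A; exact: p0..].
rewrite (eq_measure_integral mzero); last by move=> A mA _; exact: p0.
by rewrite integral_measure_zero add0e.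
Qed.

End null_plan.

(** * The singular part *)

Section singular_part.
Context d (T : measurableType d) (R : realType).
Local Open Scope ereal_scope.
Variables (mu rho : {finite_measure set T -> \bar R})
  (mus : {measure set T -> \bar R}) (f : T -> \bar R) (r : T -> R).
Hypotheses (hdec : lebesgue_decomposition mu rho f mus) (hr : has_density rho mu r).

Lemma measurable_density_pos : measurable [set x | (0 < r x)%R].
Proof.
have [mr _ _] := hr.
have : measurable_fun setT (fun x => 0 < r x)%R by exact: measurable_fun_ltr.
by move=> /(_ measurableT [set true]); rewrite setTI; exact.
Qed.

Lemma singular_part_le A : measurable A -> mus A <= mu A.
Proof.
move=> mA; have [mf f0 h _] := hdec.
by rewrite h// leeDr//; exact: integral_ge0.
Qed.

(** The absolutely continuous part does not charge [{r = 0}], which is null for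
    [rho]; conversely [mus] is carried by a [rho]-null set, on which [r] vanishes
    up to a [mu]-null set, so that [mus] does not charge [{0 < r}]. *)
Lemma singular_partE : mus setT = mu (~` [set x | (0 < r x)%R]).
Proof.
have [mf f0 h [N [mN musN rhoN]]] := hdec; have [mr r0 rE] := hr.
have mP := measurable_density_pos; have mPC := measurableC mP; have mNC := measurableC mN.
set P := [set x | _] in mP mPC *.
have rhoPC : rho (~` P) = 0.
  rewrite rE//; apply: integral0_eq => x /= /negP; rewrite lt_neqAle r0 andbT negbK.
  by move=> /eqP <-.
have -> : mu (~` P) = mus (~` P).
  by rewrite h// null_set_integral ?add0e//; exact: measurable_funTS.
have mu0 : mu (P `&` ~` N) = 0.
  have mPN : measurable (P `&` ~` N) by exact: measurableI.
  have i0 : ae_eq mu (~` N) (EFin \o r) (cst 0).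
    apply/ae_eq_integral_abs => //; first exact/measurable_EFinP/measurable_funTS.
    by under eq_integral do rewrite /= ger0_norm//; rewrite -rE.
  have [M [mM M0 PM]] := i0.
  apply/eqP; rewrite -measure_le0 -M0 le_measure ?inE// => x [Px Nx].
  apply: PM => /= /(_ Nx) [rx]; by rewrite /P /= rx ltxx in Px.
have musP : mus P = 0.
  have mPN : measurable (P `&` N) by exact: measurableI.
  have mPNC : measurable (P `&` ~` N) by exact: measurableI.
  have -> : mus P = mus (P `&` N) + mus (P `&` ~` N).
    rewrite -measureU -?setIUr ?setUv ?setIT//.
    by rewrite -setIIr setICr setI0.
  rewrite (subset_measure0 mPN mN (@subIsetr _ P N) musN) add0e.
  by apply/eqP; rewrite -measure_le0 -mu0; exact: singular_part_le.
have -> : mus setT = mus P + mus (~` P) by rewrite -measureU ?setUv// setICr.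
by rewrite musP add0e.
Qed.

Lemma ae_of_decomposition (Q : T -> Prop) :
  {ae rho, forall x, Q x} -> {ae mus, forall x, Q x} -> {ae mu, forall x, Q x}.
Proof.
move=> [N [mN N0 QN]] [M [mM M0 QM]]; exists (N `&` M); split.
- exact: measurableI.
- have [mf f0 h _] := hdec; have mNM := measurableI _ _ mN mM.
  rewrite h// null_set_integral ?add0e//.
  + by apply/eqP; rewrite -measure_le0 -M0 le_measure ?inE//; exact: subIsetr.
  + exact: measurable_funTS.
  + by apply/eqP; rewrite -measure_le0 -N0 le_measure ?inE//; exact: subIsetl.
- by move=> x nQ; split; [exact: QN|exact: QM].
Qed.

End singular_part.

Section inverse_density.
Context d (T : measurableType d) (R : realType).
Local Open Scope ereal_scope.

Lemma measurable_inv_ge0 (w : T -> R) : measurable_fun setT w ->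
  (forall x, 0 <= w x)%R -> measurable_fun setT (fun x => (w x)^-1)%R.
Proof.
move=> mw w0.
apply: (eq_measurable_fun (fun x => if (0 < w x)%R then expR (- ln (w x))%R else 0%R)).
  move=> x _; case: ifPn => [wx|]; first by rewrite expRN lnK// posrE.
  by rewrite -leNgt => h; rewrite (_ : (w x = 0)%R) ?invr0//; apply/eqP; rewrite eq_le h w0.
apply: measurable_fun_ifT => //; first exact: measurable_fun_ltr.
apply: measurableT_comp => //.
by apply: measurable_funN; apply: measurableT_comp => //; exact: measurable_ln.
Qed.

Lemma integral_inv_density (nu mu : {finite_measure set T -> \bar R}) (w : T -> R) :
  has_density nu mu w ->
  \int[nu]_x ((w x)^-1)%:E = mu [set x | (0 < w x)%R].
Proof.
move=> hw; have [mw w0 _] := hw; have mP := measurable_density_pos hw.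
rewrite (ge0_integral_density hw); last 2 first.
- exact/measurable_EFinP/measurable_inv_ge0.
- by move=> x; rewrite lee_fin invr_ge0.
transitivity (\int[mu]_x (\1_[set x | (0 < w x)%R] x)%:E).
  apply: eq_integral => x _; rewrite -EFinM indicE; congr (_%:E).
  case: (boolP (x \in _)); rewrite ?inE ?notin_setE /= => wx.
    by rewrite mulVf// gt_eqF.
  by rewrite (_ : (w x = 0)%R) ?mulr0//; apply/eqP; rewrite eq_le w0 leNgt andbT; exact/negP.
by rewrite integral_indic// setIT.
Qed.

End inverse_density.

(** * The spherical logarithm *)

Section tangent_norm_lemmas.
Context (R : realType) (n : nat) (X : pmetricType R) (M : riemannian_structure n X).

Lemma tangent_normZ (x : X) (c : R) (u : 'rV[R]_n) :
  tangent_norm M x (c *: u) = `|c| * tangent_norm M x u.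
Proof.
rewrite /tangent_norm -scalemxAl linearZ /= -scalemxAl linearZ /= scalerA !mxE.
by rewrite -expr2 sqrtrM ?sqr_ge0// sqrtr_sqr.
Qed.

Lemma tangent_norm0 (x : X) : tangent_norm M x 0 = 0.
Proof. by rewrite -(scale0r 0) tangent_normZ normr0 mul0r. Qed.

Lemma tangent_norm_log (x y : X) (kappa s : R) (L : 'rV[R]_n) : x <> y ->
  is_manifold_log M x y L ->
  tangent_norm M x ((kappa * s * tan (tangent_norm M x L / kappa) /
    tangent_norm M x L) *: L) ^+ 2
  = kappa ^+ 2 * (s ^+ 2 * tan (mdist x y / kappa) ^+ 2).
Proof.
move=> xy [_ _ e]; rewrite tangent_normZ exprMn real_normK ?num_real// e.
have : mdist x y != 0.
  by rewrite gt_eqF// mdist_gt0; apply/eqP.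
by move=> d0; field.
Qed.

End tangent_norm_lemmas.

(** [1 - m ^+ 2] is the squared sine of [acos m]; it is zero when [acos m] is, the
    case in which the speed is read as [1]. *)
Lemma speed_sqr (R : realType) (m : R) : 0 <= m <= 1 ->
  let theta := acos m in
  (if theta == 0 then 1 else theta / sin theta) ^+ 2 * (1 - m ^+ 2) = theta ^+ 2.
Proof.
move=> /andP[m0 m1] /=.
have mI : -1 <= m <= 1 by lra.
have sE := sin_acos mI; have cE : cos (acos m) = m by apply: acosK; rewrite in_itv.
have m2 : 0 <= 1 - m ^+ 2 by rewrite subr_ge0 expr_le1.
have s2 : sin (acos m) ^+ 2 = 1 - m ^+ 2 by rewrite sE sqr_sqrtr.
case: ifPn => [/eqP t0|t0].
  by rewrite t0 -cE t0 cos0 expr1n subrr mulr0 expr0n.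
have [m1'|m1'] := eqVneq m 1; first by rewrite m1' acos1 eqxx in t0.
have sn0 : sin (acos m) != 0.
  by rewrite -sqrf_eq0 s2 subr_eq0 eq_sym sqrf_eq1 negb_or m1'/=; lra.
by rewrite -s2; field.
Qed.

Section optimal_plan.
Context (R : realType) (n : nat) (X : pmetricType R) (M : riemannian_structure n X).
Variables (kappa : R) (mu0 mu1 : probability (borel X) R).
Hypothesis kappa_gt0 : 0 < kappa.
Variables (plan : {finite_measure set (borel X * borel X)%type -> \bar R}).
Hypothesis plan_opt : HK_optimal kappa mu0 mu1 plan.
Local Open Scope ereal_scope.

Let scX := manifold_second_countable M.
Let mc := measurable_HK_cost kappa scX.
Let c0 := HK_cost_ge0 (X := X) kappa.
Let k0 : (0 < kappa ^+ 2)%R. Proof. by rewrite exprn_gt0. Qed.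

Notation obj := (transport_objective (HK_cost kappa) (kappa ^+ 2) mu0 mu1).

Lemma HK_optimal_min plan' : obj plan <= obj plan'.
Proof. by rewrite [leLHS]plan_opt; apply: ereal_inf_lbound; exists plan'. Qed.

Lemma HK_optimal_fin : obj plan < +oo.
Proof.
apply: (le_lt_trans (HK_optimal_min (mscale (NngNum (lexx (0 : R)%R)) plan))).
rewrite transport_objective_null; last by move=> A; exact: mul0e.
rewrite [X in _ * X + _](probability_setT mu0) [X in _ + _ * X](probability_setT mu1).
by rewrite !mule1 -EFinD ltry.
Qed.

Variables (r0 r1 : borel X -> R).
Hypotheses (hr0 : has_density (marginal0 plan) mu0 r0)
  (hr1 : has_density (marginal1 plan) mu1 r1).

Lemma HK_sq_mass : HK_sq kappa mu0 mu1 =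
  (2 * kappa ^+ 2 * (1 - fine (plan setT)))%:E.
Proof.
rewrite -plan_opt.
have := transport_objective_optimal mc c0 k0 HK_optimal_fin hr0 hr1 HK_optimal_min.
move=> e; etransitivity; first exact: e.
rewrite [X in _ * (X + _)](probability_setT mu0) [X in _ * (_ + X)](probability_setT mu1).
rewrite -(fineK (fin_num_measure plan _ measurableT)) /=.
by congr (_%:E); ring.
Qed.

Lemma plan_ae_cos : {ae plan, forall z,
  [/\ 0 < r1 z.2, 0 < cos (mdist (z.1 : X) z.2 / kappa) &
      r0 z.1 * r1 z.2 = cos (mdist (z.1 : X) z.2 / kappa) ^+ 2]%R}.
Proof.
have h := optimality_condition mc c0 k0 HK_optimal_fin hr0 hr1 HK_optimal_min.
have h0 : {ae plan, forall z, (0 < r0 z.1)%R}.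
  have [N [mN N0 rN]] := density_gt0_ae hr0; exists (fst @^-1` N); split => //.
    by rewrite -[X in measurable X]setTI; exact: measurable_fst.
  by move=> z /= nz; apply: rN.
have h1 : {ae plan, forall z, (0 < r1 z.2)%R}.
  have [N [mN N0 rN]] := density_gt0_ae hr1; exists (snd @^-1` N); split => //.
    by rewrite -[X in measurable X]setTI; exact: measurable_snd.
  by move=> z /= nz; apply: rN.
apply: filterS3 h h0 h1 => z e a0 b0.
by have [] := HK_cost_eq_ln kappa_gt0 a0 b0 e.
Qed.

Variables (T : borel X -> borel X).
Hypotheses (mT : measurable_fun setT T)
  (planE : forall A, measurable A ->
         plan A = pushforward (marginal0 plan) (fun x => (x, T x)) A).

Let mgraph : measurable_fun setT (fun x : borel X => (x, T x)).
Proof. by apply: measurable_fun_pair. Qed.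

Lemma density_ae_cos : {ae mu0, forall x, (0 < r0 x)%R ->
  [/\ 0 < r1 (T x), 0 < cos (mdist (x : X) (T x) / kappa) &
      r0 x * r1 (T x) = cos (mdist (x : X) (T x) / kappa) ^+ 2]%R}.
Proof.
apply: (ae_density hr0); have [N [mN N0 PN]] := plan_ae_cos.
exists ((fun x => (x, T x)) @^-1` N); split.
- by rewrite -[X in measurable X]setTI; exact: mgraph.
- by rewrite -N0 planE.
- by move=> x /= nx; apply: PN.
Qed.

(** The factor [r0] turns [mu0] into the first marginal of the plan, and the plan
    carries [1 / r1 (T x)] to [1 / r1] on the second marginal. *)
Lemma integral_transport_ratio :
  \int[mu0]_x (r0 x / r1 (T x))%:E = mu1 [set x | (0 < r1 x)%R].
Proof.
have [mr0 r00 _] := hr0; have [mr1 r10 _] := hr1.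
have minv : measurable_fun setT (fun y => ((r1 y)^-1)%:E).
  exact/measurable_EFinP/measurable_inv_ge0.
have inv0 y : 0 <= ((r1 y)^-1)%:E by rewrite lee_fin invr_ge0.
rewrite -(integral_inv_density hr1).
have -> : \int[marginal1 plan]_y ((r1 y)^-1)%:E = \int[plan]_z ((r1 z.2)^-1)%:E.
  by rewrite ge0_integral_pushforward.
have -> : \int[plan]_z ((r1 z.2)^-1)%:E = \int[marginal0 plan]_x ((r1 (T x))^-1)%:E.
  rewrite (eq_measure_integral (pushforward (marginal0 plan) (fun x => (x, T x)))).
    rewrite ge0_integral_pushforward//.
    exact: measurableT_comp minv measurable_snd.
  by move=> A mA _; exact: planE.
rewrite (ge0_integral_density hr0)//; last exact: measurableT_comp minv mT.
by apply: eq_integral => x _; rewrite -EFinM mulrC.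
Qed.

Variables (mu1_s : {measure set (borel X) -> \bar R}) (f1 : borel X -> \bar R).
Hypothesis hdec1 : lebesgue_decomposition mu1 (marginal1 plan) f1 mu1_s.

(** [1 + tan ^+ 2 = cos ^- 2], and [cos ^+ 2 = r0 x * r1 (T x)] wherever [r0] is
    positive; both sides vanish elsewhere. *)
Lemma density_tan_ae : {ae mu0, forall x,
  r0 x ^+ 2 * tan (mdist (x : X) (T x) / kappa) ^+ 2 =
  r0 x / r1 (T x) - r0 x ^+ 2}%R.
Proof.
apply: filterS density_ae_cos => x; have [_ r00 _] := hr0.
have [->|rx] := eqVneq (r0 x) 0%R; first by rewrite !mul0r expr0n subrr mul0r.
have rx0 : (0 < r0 x)%R by rewrite lt_neqAle eq_sym rx r00.
move=> /(_ rx0) [r1x cx e].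
have cx0 : cos (mdist (x : X) (T x) / kappa) != 0%R by rewrite gt_eqF.
have := cos2_tan2 cx0; rewrite -e => h.
rewrite (_ : tan _ ^+ 2 = (r0 x * r1 (T x))^-1 - 1)%R; last by rewrite h; ring.
by field; rewrite !gt_eqF.
Qed.

Let m := fine (plan setT).

Let plan_mass : \int[mu0]_x (r0 x)%:E = m%:E.
Proof.
have [_ _ rE] := hr0; rewrite -rE// /m fineK//.
exact: (fin_num_measure plan _ measurableT).
Qed.

(** Stated with a free factor [s], so as to give both the theorem and, by the
    nonnegativity of the left-hand side, the bound [m <= 1] without which
    [acos m] would be meaningless. *)
Lemma spherical_energy (s : R) (V W : borel X -> \bar R) :
  (forall x, 0 <= V x) -> (forall x, 0 <= W x) ->
  {ae mu0, forall x, V x = (kappa ^+ 2 * s ^+ 2 *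
     (r0 x ^+ 2 * tan (mdist (x : X) (T x) / kappa) ^+ 2))%:E} ->
  {ae mu0, forall x, W x = (4 * s ^+ 2 * (r0 x - m) ^+ 2)%:E} ->
  \int[mu0]_x V x + (kappa ^+ 2 / 4)%:E * \int[mu0]_x W x
    + (kappa ^+ 2)%:E * ((s ^+ 2)%:E * mu1_s setT)
  = (kappa ^+ 2 * s ^+ 2 * (1 - m ^+ 2))%:E.
Proof.
move=> V0 W0 VE WE.
have [mr0 r00 _] := hr0; have [mr1 r10 _] := hr1.
have ks0 : (0 <= kappa ^+ 2 * s ^+ 2)%R by rewrite mulr_ge0// sqr_ge0.
have s40 : (0 <= 4 * s ^+ 2)%R by rewrite mulr_ge0// sqr_ge0.
pose q x := (r0 x / r1 (T x))%R.
have mq : measurable_fun setT q.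
  apply: measurable_funM => //.
  exact: measurableT_comp (measurable_inv_ge0 mr1 r10) mT.
have q0 x : (0 <= q x)%R by rewrite divr_ge0.
(* a measurable representative of [r0 ^+ 2 * tan ^+ 2], made nonnegative off the
   null set where the optimality condition fails *)
pose v x := Num.max (q x - r0 x ^+ 2)%R 0%R.
have mv : measurable_fun setT v.
  apply: measurable_maxr => //; apply: measurable_funB => //.
  exact: measurable_funX.
have v0 x : (0 <= v x)%R by rewrite le_max lexx orbT.
have v_ae : {ae mu0, forall x, v x = (q x - r0 x ^+ 2)%R /\
    v x = (r0 x ^+ 2 * tan (mdist (x : X) (T x) / kappa) ^+ 2)%R}.
  apply: filterS density_tan_ae => x e; rewrite /v /q -e.
  by split; apply/max_idPl; rewrite mulr_ge0// sqr_ge0.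
pose w x := ((r0 x - m) ^+ 2)%R.
have mw : measurable_fun setT w by apply: measurable_funX; exact: measurable_funB.
have w0 x : (0 <= w x)%R by exact: sqr_ge0.
have m0 : (0 <= m)%R by rewrite fine_ge0.
have -> : \int[mu0]_x V x = (kappa ^+ 2 * s ^+ 2)%:E * \int[mu0]_x (v x)%:E.
  rewrite -ge0_integralZl_EFin//; last 2 first.
  - by move=> x _; rewrite lee_fin.
  - exact/measurable_EFinP.
  apply: integral_ge0_ae_eq => [x|x|]; [exact: V0|by rewrite mule_ge0// lee_fin|].
  apply: filterS2 VE v_ae => x -> [_ ->].
  by rewrite EFinM.
have -> : \int[mu0]_x W x = (4 * s ^+ 2)%:E * \int[mu0]_x (w x)%:E.
  rewrite -ge0_integralZl_EFin//; last 2 first.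
  - by move=> x _; rewrite lee_fin.
  - exact/measurable_EFinP.
  apply: integral_ge0_ae_eq => [x|x|]; [exact: W0|by rewrite mule_ge0// lee_fin|].
  by apply: filterS WE => x ->; rewrite EFinM.
have energy : \int[mu0]_x (v x)%:E + \int[mu0]_x (w x)%:E + (2 * m * m)%:E =
    mu1 [set x | (0 < r1 x)%R] + (m ^+ 2)%:E.
  rewrite -integral_transport_ratio EFinM -plan_mass.
  have -> : (m ^+ 2)%:E = \int[mu0]_x (cst (m ^+ 2)%:E x).
    by rewrite integral_cst// [X in _ * X](probability_setT mu0) mule1.
  have m20 : (0 <= 2 * m)%R by rewrite mulr_ge0.
  have mE (g : borel X -> R) : measurable_fun setT g ->
    measurable_fun setT (fun x => (g x)%:E) by move=> ?; exact/measurable_EFinP.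
  have [mEv mEw] := (mE _ mv, mE _ mw); have [mEq mEr] := (mE _ mq, mE _ mr0).
  have Ev x : setT x -> 0 <= (v x)%:E by rewrite lee_fin.
  have Ew x : setT x -> 0 <= (w x)%:E by rewrite lee_fin.
  have Eq x : setT x -> 0 <= (q x)%:E by rewrite lee_fin.
  have Er x : setT x -> 0 <= (r0 x)%:E by rewrite lee_fin.
  have Ec x : setT x -> 0 <= cst (m ^+ 2)%:E x :> \bar R by rewrite lee_fin sqr_ge0.
  rewrite -ge0_integralZl_EFin//.
  have m1 : measurable_fun setT (fun x => (v x)%:E + (w x)%:E).
    exact: emeasurable_funD.
  have m2 : measurable_fun setT (fun x => (2 * m)%:E * (r0 x)%:E).
    exact: emeasurable_funM.
  have E1 x : setT x -> 0 <= (v x)%:E + (w x)%:E by move=> ?; rewrite adde_ge0 ?Ev ?Ew.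
  have E2 x : setT x -> 0 <= (2 * m)%:E * (r0 x)%:E.
    by move=> ?; rewrite mule_ge0 ?Er// lee_fin.
  rewrite -[in LHS]ge0_integralD// -[in LHS]ge0_integralD// -[in RHS]ge0_integralD//; last exact: Ec.
  apply: integral_ge0_ae_eq => [x|x|].
  - by rewrite adde_ge0 ?E1 ?E2.
  - by rewrite adde_ge0 ?Eq ?Ec.
  apply: filterS v_ae => x [vE _].
  by rewrite /= -EFinM -!EFinD; congr (_%:E); rewrite vE /w /q; ring.
rewrite (singular_partE hdec1 hr1).
have mP := measurable_density_pos hr1.
have Q : mu1 (~` [set x | (0 < r1 x)%R]) = 1 - mu1 [set x | (0 < r1 x)%R].
  exact: probability_setC.
rewrite [X in (s ^+ 2)%:E * X]Q.
have Pfin := fin_num_measure mu1 _ mP.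
move: energy; rewrite -(fineK Pfin).
have : 0 <= \int[mu0]_x (v x)%:E by apply: integral_ge0 => x _; rewrite lee_fin.
have : 0 <= \int[mu0]_x (w x)%:E by apply: integral_ge0 => x _; rewrite lee_fin.
case: (\int[mu0]_x (v x)%:E) => [a| |]//; case: (\int[mu0]_x (w x)%:E) => [b| |]// _ _.
rewrite -!EFinD => -[e]; congr (_%:E).
have -> : (a = fine (mu1 [set x | (0 < r1 x)%R]) + m ^+ 2 - 2 * m * m - b)%R by rewrite -e; ring.
by field.
Qed.

(** The energy with [s = 1 / kappa] equals [1 - m ^+ 2] and is nonnegative. *)
Lemma plan_mass_le1 : (0 <= m <= 1)%R.
Proof.
have m0 : (0 <= m)%R by rewrite fine_ge0.
rewrite m0 /= -(expr_le1 (n := 2))//.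
have ki0 : (0 <= kappa ^- 2)%R by rewrite invr_ge0 sqr_ge0.
have := @spherical_energy kappa^-1%R (fun x => (kappa ^+ 2 * kappa^-1 ^+ 2 *
     (r0 x ^+ 2 * tan (mdist (x : X) (T x) / kappa) ^+ 2))%:E)
  (fun x => (4 * kappa^-1 ^+ 2 * (r0 x - m) ^+ 2)%:E).
have -> : (kappa ^+ 2 * kappa^-1 ^+ 2 = 1)%R by field; rewrite gt_eqF.
move=> /(_ _ _ (aeW _ (fun=> erefl)) (aeW _ (fun=> erefl))) h.
have V0 x : 0 <= (1 * (r0 x ^+ 2 * tan (mdist (x : X) (T x) / kappa) ^+ 2))%:E.
  by rewrite lee_fin mul1r mulr_ge0// sqr_ge0.
have W0 x : 0 <= (4 * kappa^-1 ^+ 2 * (r0 x - m) ^+ 2)%:E.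
  by rewrite lee_fin mulr_ge0 ?sqr_ge0// mulr_ge0// sqr_ge0.
have : 0 <= (1 * (1 - m ^+ 2))%:E.
  have sq (a : R) : 0 <= (a ^+ 2)%:E by rewrite lee_fin sqr_ge0.
  rewrite -(h V0 W0) adde_ge0//; last by rewrite !mule_ge0.
  rewrite adde_ge0//; first exact: integral_ge0.
  by rewrite mule_ge0//; [rewrite lee_fin divr_ge0 ?sqr_ge0|exact: integral_ge0].
by rewrite lee_fin mul1r subr_ge0.
Qed.

Variables (v0 : X -> 'rV[R]_n) (alpha0 : X -> R).
Variables (mu0_s : {measure set (borel X) -> \bar R}) (f0 : borel X -> \bar R).
Hypothesis hdec0 : lebesgue_decomposition mu0 (marginal0 plan) f0 mu0_s.
Let sigma0 x := fine (density (marginal0 plan) mu0 x).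
Hypothesis hlog : {ae marginal0 plan, forall x,
         [/\ T x = x -> v0 x = 0%R,
             T x <> x -> exists2 L, is_manifold_log M x (T x) L &
               v0 x = (kappa * sigma0 x * tan (tangent_norm M x L / kappa)
                       / tangent_norm M x L)%R *: L &
             alpha0 x = (2 * (sigma0 x - 1))%R]}.
Hypothesis hlog_s : {ae mu0_s, forall x, v0 x = 0%R /\ alpha0 x = (-2)%R}.

(** The two almost-everywhere clauses defining the logarithm merge into one: the
    [mu0]-null sets on [{0 < r0}] are governed by the first marginal, and on
    [{r0 = 0}] by [mu0_s], where the prescribed values [0] and [-2] are those
    given by the general formulas at [r0 = 0]. *)
Lemma HK_log_ae : {ae mu0, forall x,
  tangent_norm M x (v0 x) ^+ 2 =
    kappa ^+ 2 * (r0 x ^+ 2 * tan (mdist (x : X) (T x) / kappa) ^+ 2) /\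
  alpha0 x = 2 * (r0 x - 1)}%R.
Proof.
have [mr0 r00 r0E] := hr0.
have sE := density_ae hr0.
have pos := ae_density hr0 hlog.
have zero : {ae mu0, forall x, r0 x = 0%R -> v0 x = 0%R /\ alpha0 x = (-2)%R}.
  apply: (ae_of_decomposition hdec0).
    by apply: filterS (density_gt0_ae hr0) => x rx e; rewrite e ltxx in rx.
  have [N [mN N0 PN]] := hlog_s; exists N; split=> // x nx; apply: PN => hx.
  by apply: nx => _.
apply: filterS3 sE pos zero => x sx px zx.
have [rx|rx] := eqVneq (r0 x) 0%R.
  have [-> ->] := zx rx; rewrite tangent_norm0 rx; split; first by rewrite expr0n !mul0r mulr0.
  by ring.
have rx0 : (0 < r0 x)%R by rewrite lt_neqAle eq_sym rx r00.
have [h1 h2 h3] := px rx0.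
have sx' : sigma0 x = r0 x by rewrite /sigma0 sx.
split; last by rewrite h3 sx'.
have [Tx|Tx] := pselect (T x = x).
  by rewrite h1// tangent_norm0 Tx mdistxx mul0r tan0 expr0n !mulr0.
have [L hL ->] := h2 Tx; rewrite sx'.
exact: tangent_norm_log (nesym Tx) hL.
Qed.

End optimal_plan.

Unset Implicit Arguments.

Theorem proposition3p21 (R : realType) (n : nat) (X : pmetricType R)
    (M : riemannian_structure n X)
    (hM : is_riemannian_metric M)
    (connectedX : connected [set: X])
    (completeX : metrically_complete X)
    (vol : {measure set (borel X) -> \bar R})
    (hvol : is_riemannian_volume M vol)
    (kappa : R) (kappa_gt0 : 0 < kappa)
    (mu0 mu1 : probability (borel X) R)
    (mu0_vol : mu0 `<< vol)
    (vS : X -> 'rV[R]_n) (alphaS : X -> R)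
    (mu1S_s : {measure set (borel X) -> \bar R})
    (hlog : is_SHK_log kappa M mu0 mu1 vS alphaS mu1S_s) :
  ((SHK kappa mu0 mu1 ^+ 2)%:E =
   L2norm_sq_vector M mu0 vS + (kappa ^+ 2 / 4)%:E * L2norm_sq mu0 alphaS
   + (kappa ^+ 2)%:E * mu1S_s [set: X])%E.
Proof.
have [v0 [alpha0 [mu1_s [[plan [T [f0 [f1 [mu0_s]]]]]]]]] := hlog.
move=> [opt [mT planE] [dec0 dec1] ae_log ae_log_s] vSE alphaSE mu1SE.
have fin := HK_optimal_fin opt.
have c0 := HK_cost_ge0 (X := X) kappa.
have k0 : 0 < kappa ^+ 2 by rewrite exprn_gt0.
have [_ KL0 KL1] := transport_objective_lty c0 k0 fin.
have hr0 := has_density_dominated (KL_lty_dominated KL0).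
have hr1 := has_density_dominated (KL_lty_dominated KL1).
set r0 := fine \o _ in hr0; set r1 := fine \o _ in hr1.
pose m := fine (plan setT).
have HKE := HK_sq_mass M kappa_gt0 opt hr0 hr1.
have m01 : 0 <= m <= 1 := plan_mass_le1 M kappa_gt0 opt hr0 hr1 mT planE dec1.
have knz : kappa != 0 by rewrite gt_eqF.
have SHKE : SHK kappa mu0 mu1 = kappa * acos m.
  by rewrite /SHK HKE /=; congr (_ * acos _); rewrite -/m; field.
set s := SHK_speed kappa mu0 mu1.
have sE : s ^+ 2 * (1 - m ^+ 2) = acos m ^+ 2.
  rewrite -speed_sqr// /s /SHK_speed SHKE.
  by rewrite (_ : kappa * acos m / kappa = acos m)//; field.
rewrite mu1SE// -/s /L2norm_sq_vector /L2norm_sq.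
have logE := HK_log_ae hr0 dec0 ae_log ae_log_s.
rewrite (spherical_energy M kappa_gt0 opt hr0 hr1 mT planE dec1 (s := s)).
- by rewrite -mulrA sE SHKE exprMn.
- by move=> x; rewrite lee_fin sqr_ge0.
- by move=> x; rewrite lee_fin sqr_ge0.
- have [N [mN N0 PN]] := logE; exists N; split=> // x nx; apply: PN => -[h _].
  apply: nx => /=; rewrite vSE tangent_normZ exprMn h.
  by rewrite real_normK ?num_real// -/s; congr (_%:E); ring.
- have [N [mN N0 PN]] := logE; exists N; split=> // x nx; apply: PN => -[_ h].
  apply: nx => /=; rewrite alphaSE h HKE /= -/s -/m.
  by congr (_%:E); field.
Qed.
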